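(* Let $\delta\in(0,\infty)$, $s\in(0,1)$, $0<\alpha<1-s$. Then for all $u\in H^{s+\alpha}_\Omega(\mathbb{R}^n)$ and $v\in H^s_\Omega(\mathbb{R}^n)$ the following hold. (i) The second mixed derivative of the bilinear form $a(u,v;s,\delta)$ with respect to $\delta$ and $s$ exists and is given by $$a''_{s,\delta}(u,v;s,\delta):=\frac{\partial^2}{\partial s\,\partial\delta}\,a(u,v;s,\delta)=-2\int_{\mathbb{R}^n}\int_{\partial B_\delta(x)}\frac{(u(x)-u(y))(v(x)-v(y))\log(|x-y|)}{|x-y|^{n+2s}}\,dy\,dx,$$ where $\partial B_\delta(x)=\{y\in\mathbb{R}^n: |x-y|=\delta\}$ and the inner integral is a surface integral. (ii) The mixed derivative is bounded: $$|a''_{s,\delta}(u,v;s,\delta)|\le C\,\|u\|_{L^2(\Omega)}\|v\|_{L^2(\Omega)},$$ with a constant $C$ (independent of $u,v$) depending continuously on $s$ and $\delta$.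
   Context: $\Omega\subset\mathbb{R}^n$, $n\ge1$, is a bounded domain with $C^\infty$ boundary. For $s\in(0,1)$ and $\delta\in(0,\infty)$, $$a(u,v;s,\delta)=\iint_{\{(x,y)\in\mathbb{R}^{2n}:|x-y|\le\delta\}}\frac{(u(x)-u(y))(v(x)-v(y))}{|x-y|^{n+2s}}\,dy\,dx .$$ $H^t_\Omega(\mathbb{R}^n)=\{v\in H^t(\mathbb{R}^n): v=0\text{ on }\mathbb{R}^n\setminus\Omega\}$, equipped with the (Gagliardo) seminorm of $H^t(\mathbb{R}^n)$ as norm. *)

(* Defs.v *)
From HB Require Import structures.
From mathcomp Require Import all_boot all_order all_algebra.
From mathcomp Require Import all_classical all_reals all_analysis.

Set Implicit Arguments.
Unset Strict Implicit.
Unset Printing Implicit Defensive.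
Import Order.TTheory GRing.Theory Num.Theory.
Import numFieldNormedType.Exports.
Local Open Scope classical_set_scope.
Local Open Scope ring_scope.

(* R^n is 'rV[R]_n.  Its library norm is the sup norm, used here only through
   the topology and boundedness; distances are Euclidean (enorm below). *)

Definition measure_rV_display : measure_display.
Proof. exact: default_measure_display. Qed.

Section measurable_rV.
Context {R : realType} (n : nat).

Let coors : 'I_n -> 'rV[R]_n -> R := fun i x => x 0 i.

Let rV_set0 : g_sigma_preimage coors set0.
Proof. exact: sigma_algebra0. Qed.

Let rV_setC A : g_sigma_preimage coors A -> g_sigma_preimage coors (~` A).
Proof. exact: sigma_algebraC. Qed.

Let rV_bigcup (F : _^nat) : (forall i, g_sigma_preimage coors (F i)) ->
  g_sigma_preimage coors (\bigcup_i (F i)).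
Proof. exact: sigma_algebra_bigcup. Qed.

(* the Borel sigma-algebra, as the product of the Borel sigma-algebras on R *)
HB.instance Definition _ := @isMeasurable.Build measure_rV_display
  'rV[R]_n (g_sigma_preimage coors) rV_set0 rV_setC rV_bigcup.

End measurable_rV.

Lemma measurable_coor (R : realType) n (i : 'I_n) :
  measurable_fun [set: 'rV[R]_n] (fun x : 'rV[R]_n => x 0 i).
Proof.
move=> _ Y mY; rewrite setTI; apply: sub_sigma_algebra => /=.
rewrite -bigcup_seq/=; exists i => /=; first by rewrite mem_index_enum.
by exists Y => //; rewrite setTI.
Qed.

Lemma measurable_fun_coorP d (T : measurableType d) (R : realType) n
    (f : T -> 'rV[R]_n) :
  measurable_fun [set: T] f <->
  forall i, measurable_fun [set: T] (fun t => f t 0 i).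
Proof.
split=> [mf i|mf].
  exact: (measurableT_comp (measurable_coor i)).
suff sub : g_sigma_preimage (fun i (x : 'rV[R]_n) => x 0 i) `<=`
    [set A | measurable (f @^-1` A)].
  by move=> _ A mA; rewrite setTI; exact: sub.
apply: smallest_sub.
  split=> /=.
  - by rewrite preimage_set0.
  - by move=> A mA; rewrite setTD preimage_setC; exact: measurableC.
  - by move=> F mF; rewrite preimage_bigcup; exact: bigcup_measurable.
rewrite -bigcup_seq => A [i _ [B mB <-]] /=.
by rewrite setTI -[X in measurable X]setTI; exact: mf.
Qed.

Definition cons_rV (R : realType) n (p : R * 'rV[R]_n) : 'rV[R]_n.+1 :=
  row_mx p.1%:M p.2 : 'rV_(1 + n).

Lemma measurable_cons_rV (R : realType) n :
  measurable_fun [set: R * 'rV[R]_n] (@cons_rV R n).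
Proof.
apply/measurable_fun_coorP => i.
rewrite (_ : (fun _ => _) = fun p : R * 'rV[R]_n =>
    if fintype.split (i : 'I_(1 + n)) is inr j then p.2 0 j else p.1).
  case: fintype.split => j; first exact: measurable_fst.
  exact: (measurableT_comp (measurable_coor j)).
apply/funext => p; rewrite /cons_rV mxE; case: fintype.split => // j.
by rewrite ord1 mxE eqxx mulr1n.
Qed.

Section lebesgue_rV_step.
Context (R : realType) (n : nat).
Variable mu : {sigma_finite_measure set 'rV[R]_n -> \bar R}.

Definition lebesgue_rV_step : set 'rV[R]_n.+1 -> \bar R :=
  pushforward (lebesgue_measure \x mu)%E (@cons_rV R n).

Let step0 : lebesgue_rV_step set0 = 0%E.
Proof. by rewrite /lebesgue_rV_step /pushforward preimage_set0 measure0. Qed.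

Let step_ge0 A : (0 <= lebesgue_rV_step A)%E.
Proof. by rewrite /lebesgue_rV_step /pushforward measure_ge0. Qed.

Let step_sigma_additive : semi_sigma_additive lebesgue_rV_step.
Proof.
have mc := @measurable_cons_rV R n.
move=> F mF tF mUF; rewrite /lebesgue_rV_step /pushforward preimage_bigcup.
apply: measure_semi_sigma_additive.
- by move=> k; rewrite -[X in measurable X]setTI; exact: mc.
- apply/trivIsetP => /= i j _ _ ij; rewrite -preimage_setI.
  by move/trivIsetP : tF => /(_ _ _ _ _ ij) ->//; rewrite preimage_set0.
- by rewrite -preimage_bigcup -[X in measurable X]setTI; exact: mc.
Qed.

HB.instance Definition _ := isMeasure.Build _ _ _ lebesgue_rV_step
  step0 step_ge0 step_sigma_additive.

Let lebesgue_rV_step_sigma_finite : sigma_finite setT lebesgue_rV_step.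
Proof.
have /sigma_finiteP[F [FT ndF Foo]] := sigma_finiteT (@lebesgue_measure R).
have /sigma_finiteP[G [GT ndG Goo]] := sigma_finiteT mu.
exists (fun k => [set x : 'rV[R]_n.+1 |
    F k (x 0 0) /\ G k (rsubmx (x : 'rV_(1 + n)))]).
  apply/esym/seteqP; split => // x _.
  have [i _ Fi] : (\bigcup_i F i) (x 0 0) by rewrite -FT.
  have [j _ Gj] : (\bigcup_j G j) (rsubmx (x : 'rV_(1 + n))) by rewrite -GT.
  exists (maxn i j) => //; split.
    by move: Fi; exact/subsetPset/ndF/leq_maxl.
  by move: Gj; exact/subsetPset/ndG/leq_maxr.
move=> k; have [mF Fk] := Foo k; have [mG Gk] := Goo k; split.
  apply: measurableI.
    by rewrite -[X in measurable X]setTI; exact: measurable_coor.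
  rewrite -[X in measurable X]setTI.
  have mr : measurable_fun [set: 'rV[R]_n.+1]
      (fun x => rsubmx (x : 'rV_(1 + n))).
    apply/measurable_fun_coorP => i.
    by under eq_fun do rewrite mxE; exact: measurable_coor.
  exact: mr.
rewrite /lebesgue_rV_step /pushforward.
rewrite (_ : (@cons_rV R n) @^-1` _ = F k `*` G k).
  by rewrite product_measure1E// lte_mul_pinfty// ge0_fin_numE.
apply/seteqP; split => -[t y] /=; rewrite /cons_rV row_mxKr/=.
  by rewrite mxE; case: fintype.splitP => // j _; rewrite ord1 mxE eqxx mulr1n.
by rewrite mxE; case: fintype.splitP => // j _; rewrite ord1 mxE eqxx mulr1n.
Qed.

HB.instance Definition _ := Measure_isSigmaFinite.Build _ _ _
  lebesgue_rV_step lebesgue_rV_step_sigma_finite.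

End lebesgue_rV_step.

Fixpoint lebesgue_rV (R : realType) n :
    {sigma_finite_measure set 'rV[R]_n -> \bar R} :=
  match n with
  | 0 => dirac (0 : 'rV[R]_0)
  | m.+1 => lebesgue_rV_step (lebesgue_rV R m)
  end.

Definition enorm (R : realType) n (x : 'rV[R]_n) : R :=
  Num.sqrt (\sum_i x 0 i ^+ 2).

Fixpoint C_k (R : realType) n (k : nat) (f : 'rV[R]_n -> R) : Prop :=
  continuous f /\
  match k with
  | 0 => True
  | k'.+1 => forall i : 'I_n,
      (forall x, derivable f x (delta_mx 0 i)) /\
      C_k k' (fun x => 'D_(delta_mx 0 i) f x)
  end.

Definition C_infty (R : realType) n (f : 'rV[R]_n -> R) : Prop :=
  forall k, C_k k f.

(* Near every boundary point, after relabelling the axes and possibly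
   reflecting the i-th one, the domain is the epigraph of a smooth function
   of the other n coordinates. *)
Definition smooth_boundary (R : realType) n (Omega : set 'rV[R]_n.+1) : Prop :=
  forall p, (closure Omega `\` interior Omega) p ->
  exists (i : 'I_n.+1) (b : bool) (gamma : 'rV[R]_n -> R),
    C_infty gamma /\
    \forall x \near p, Omega x <-> gamma (col' i x) < (-1) ^+ b * x 0 i.

Definition smooth_bounded_domain (R : realType) n
    (Omega : set 'rV[R]_n.+1) : Prop :=
  [/\ open Omega, connected Omega, Omega !=set0, bounded_set Omega &
      smooth_boundary Omega].

Section forms.
Context (R : realType) (n : nat).
Implicit Types (u v : 'rV[R]_n -> R) (s t delta : R).

Let leb := lebesgue_rV R n.

(* Below, the (null) diagonal z.1 = z.2 contributes 0, as 0 / 0 = 0. *)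
Definition gagliardo_seminorm t v : \bar R :=
  ((\int[leb \x leb]_z
      ((v z.1 - v z.2) ^+ 2 / enorm (z.1 - z.2) `^ (n%:R + 2 * t))%:E)
   `^ 2^-1)%E.

(* H^t_Omega(R^n) for 0 < t < 1; v is a Borel representative of its class, so
   "v = 0 outside Omega" is meant almost everywhere. *)
Definition H_Omega (Omega : set 'rV[R]_n) t v : Prop :=
  [/\ v \in Lfun leb 2%:E, (gagliardo_seminorm t v < +oo)%E &
      {ae leb, forall x, ~ Omega x -> v x = 0}].

Definition L2norm (Omega : set 'rV[R]_n) v : R :=
  fine 'N[leb]_2%:E[EFin \o (v \_ Omega)].

Definition form_a u v s delta : R :=
  \int[(leb \x leb)%E]_(z in [set z | enorm (z.1 - z.2) <= delta])
    ((u z.1 - u z.2) * (v z.1 - v z.2) /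
     enorm (z.1 - z.2) `^ (n%:R + 2 * s)).

End forms.

(* Surface integral of f over the Euclidean sphere of centre x and radius
   delta in R^(n+1): the two open hemispheres are the graphs of
   +/- phi, phi z := sqrt (delta^2 - |z|^2), over the ball |z| < delta of R^n,
   with surface element sqrt (1 + |grad phi|^2) = delta / phi; the equator is
   a null set. *)
Definition sphere_integral (R : realType) n (x : 'rV[R]_n.+1) (delta : R)
    (f : 'rV[R]_n.+1 -> R) : R :=
  \sum_(b : bool)
    \int[lebesgue_rV R n]_(z in [set z | enorm z < delta])
      (let phi := Num.sqrt (delta ^+ 2 - enorm z ^+ 2) in
       f (x + cons_rV ((-1) ^+ b * phi, z)) * (delta / phi)).

(* the outer derivative is the one in s: d/ds (d/d delta a) *)
Definition mixed_derivative (R : realType) n (u v : 'rV[R]_n -> R)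
    (s delta : R) : R :=
  derive1 (fun s' : R => derive1 (form_a u v s') delta) s.

(* Main.v *)
Require Import Defs.
From HB Require Import structures.
From mathcomp Require Import all_boot all_order all_algebra.
From mathcomp Require Import all_classical all_reals all_analysis.
From mathcomp Require Import measurable_realfun ring lra.
Import Order.TTheory GRing.Theory Num.Theory.
Import numFieldNormedType.Exports.
Local Open Scope classical_set_scope.
Local Open Scope ring_scope.
Set Implicit Arguments.
Unset Strict Implicit.
Unset Printing Implicit Defensive.

(** Write N for the dimension and h = y - x.  As the Lebesgue measure is
    invariant under the shear (x, y) |-> (x, y - x), the form over
    |x - y| <= delta is the integral over |h| <= delta of
    g(h) / |h|^(N + 2s), where
    g(h) = \int (u(x) - u(x + h)) (v(x) - v(x + h)) dx
    is [increment_form].  By Cauchy-Schwarz, |g| <= 4 ||u|| ||v||.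

    Moreover g is continuous, because the seminorm of v bounds
    ||v - v(. + h)|| by a power of |h|.  Indeed the squared modulus
    Q(h) = ||v - v(. + h)||^2 satisfies Q(h) <= 2 Q(h + k) + 2 Q(k), and
    averaging over the k in a cube of size |h| compares Q(h) with the integral
    of Q(k) / |k|^(N + 2s), which is the squared seminorm ([sqmodulus_holder]).
    Expanding g into correlations of u with translates of v reduces the
    continuity of g to that of the translates of v ([increment_form_holder]).

    So the derivative of the form in delta is the integral of
    g(h) / |h|^(N + 2s) over the sphere |h| = delta ([sphere_is_derive]).  The
    surface integral is taken in graph coordinates h = (t, z), and one has to
    differentiate the integral over a thin shell slice by slice.  Over |z| < delta
    the slices converge and are dominated by a multiple of
    1 / sqrt (delta^2 - |z|^2), which is integrable by the arcsine primitive
    ([integral_heightV]).  The slices over |z| >= delta, which occur only for the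
    derivative from the right, contribute the product of a bounded height
    sqrt (hi^2 - delta^2) with the volume of a shell of one dimension less, which
    is O(hi - delta) ([half_shell_outer_cvg]).

    On the sphere |h|^(N + 2s) is the constant delta^(N + 2s), so the derivative
    in delta is delta^-(N + 2s) S, with S = [sphere_increment] independent of s;
    its derivative in s is -2 ln(delta) delta^-(N + 2s) S, and Fubini moves the
    integral in x outside ([int_sphere_integral]).  The bound on g and the area of
    the sphere bound S by a multiple of ||u|| ||v|| ([sphere_increment_le]).

    The extra smoothness alpha of u makes the form converge for the exponents
    slightly above s that the derivative in s looks at ([kernel_int_le]). *)

(** * Measure-preserving maps and Lebesgue measure on R^n *)

(** Unlike a pushforward measure, this form does not ask for [phi] to be packed
    as a measurable map, and it composes under products by rewriting sections. *)
Definition preserving d1 d2 (T1 : measurableType d1) (T2 : measurableType d2)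
    (R : realType) (m1 : set T1 -> \bar R) (m2 : set T2 -> \bar R)
    (phi : T1 -> T2) :=
  measurable_fun [set: T1] phi /\
  forall A, measurable A -> m2 A = m1 (phi @^-1` A).

Section preserving.
Local Open Scope ereal_scope.
Context d1 d2 (T1 : measurableType d1) (T2 : measurableType d2) (R : realType).
Variables (m1 : {measure set T1 -> \bar R}) (m2 : {measure set T2 -> \bar R}).
Variable phi : T1 -> T2.
Hypothesis mphi : preserving m1 m2 phi.

Lemma ge0_integral_preserving (f : T2 -> \bar R) :
  measurable_fun setT f -> (forall x, 0 <= f x) ->
  \int[m2]_y f y = \int[m1]_x f (phi x).
Proof.
case: mphi => mp E mf f0.
pose mphi_mixin := isMeasurableFun.Build _ _ _ _ _ mp.
pose p : {mfun T1 >-> T2} := HB.pack phi mphi_mixin.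
transitivity (\int[pushforward m1 p]_y f y).
  by apply: eq_measure_integral => A mA _; rewrite E.
by rewrite ge0_integral_pushforward.
Qed.

(** Both sides are by definition the difference of the integrals of the positive
    and the negative part, so the nonnegative case suffices. *)
Lemma integral_preserving (f : T2 -> \bar R) :
  measurable_fun setT f -> \int[m2]_y f y = \int[m1]_x f (phi x).
Proof.
move=> mf; rewrite integralE [RHS]integralE.
rewrite (ge0_integral_preserving (measurable_funepos mf))//.
rewrite (ge0_integral_preserving (measurable_funeneg mf))//.
by congr (_ - _); apply: eq_integral => x _;
  rewrite ?(funepos_comp f phi) ?(funeneg_comp f phi).
Qed.

Lemma integrable_preserving (f : T2 -> \bar R) :
  measurable_fun setT f ->
  m2.-integrable setT f <-> m1.-integrable setT (fun x => f (phi x)).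
Proof.
move=> mf; have [mp _] := mphi; have mfp := measurableT_comp mf mp.
have -> : m2.-integrable setT f <-> \int[m2]_y `|f y| < +oo.
  by split=> [/integrableP[]//|h]; apply/integrableP.
rewrite (@ge0_integral_preserving (fun y => `|f y|))//; last first.
  exact: measurableT_comp.
by split=> [h|/integrableP[]//]; apply/integrableP.
Qed.

Lemma Rintegral_preserving (f : T2 -> R) :
  measurable_fun setT f -> (\int[m2]_y f y = \int[m1]_x f (phi x))%R.
Proof.
by move=> mf; rewrite /Rintegral (integral_preserving (f := EFin \o f))//;
  exact/measurable_EFinP.
Qed.

End preserving.

(** The product measure of a set integrates the measures of its sections; on the
    section over [x] the map acts by [g x], which preserves [m2].  This covers
    both translations of R^(n+1) and the shear (x, h) |-> (x, x + h). *)
Lemma preserving_prod d1 d2 (T1 : measurableType d1) (T2 : measurableType d2)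
    (R : realType) (m1 : {sigma_finite_measure set T1 -> \bar R})
    (m2 : {sigma_finite_measure set T2 -> \bar R})
    (f : T1 -> T1) (g : T1 -> T2 -> T2) :
  preserving m1 m1 f -> (forall x, preserving m2 m2 (g x)) ->
  measurable_fun setT (fun p => g p.1 p.2) ->
  preserving (m1 \x m2)%E (m1 \x m2)%E (fun p => (f p.1, g p.1 p.2)).
Proof.
move=> pf pg mg; split.
  apply/measurable_fun_pairP; split => //=.
  by apply: (measurableT_comp (proj1 pf)); exact: measurable_fst.
move=> A mA; rewrite /product_measure1.
rewrite (ge0_integral_preserving pf (f := m2 \o xsection A))//.
- apply: eq_integral => x _ /=.
  rewrite (proj2 (pg x)); last exact: measurable_xsection.
  by congr (m2 _); apply/seteqP; split => y /=; rewrite /xsection/= !inE.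
- exact: measurable_fun_xsection.
Qed.

Section lebesgue_rV_theory.
Context (R : realType).

Lemma lebesgue_measure_translate (a : R) :
  preserving (@lebesgue_measure R) (@lebesgue_measure R) (fun x : R => x + a).
Proof.
have ma : measurable_fun [set: R] (fun x : R => x + a).
  exact: measurable_funD.
split => // A mA.
pose phi : measurableTypeR R -> measurableTypeR R := fun x : R => x + a.
have mphi : measurable_fun setT phi by [].
pose mphi_mixin := isMeasurableFun.Build _ _ _ _ _ mphi.
pose p : {mfun measurableTypeR R >-> measurableTypeR R} :=
  HB.pack phi mphi_mixin.
apply: (@lebesgue_measure_unique R (pushforward (@lebesgue_measure R) p)) => //.
move=> _ [[b c]] _ <- /=; rewrite /pushforward.
rewrite (_ : _ @^-1` _ = `]b - a, c - a]%classic); last first.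
  by apply/seteqP; split => x /=; rewrite !in_itv/= ltrBlDr lerBrDr.
by rewrite !lebesgue_measure_itv/= !lte_fin ltrD2r -!EFinB; case: ifP => // _;
  congr EFin; ring.
Qed.

Lemma cons_rV0 n (p : R * 'rV[R]_n) : cons_rV p 0 ord0 = p.1.
Proof.
rewrite /cons_rV mxE; case: fintype.splitP => [j|j]; last by [].
by rewrite ord1 => _; rewrite mxE eqxx mulr1n.
Qed.

Lemma cons_rVS n (p : R * 'rV[R]_n) (i : 'I_n) :
  cons_rV p 0 (lift ord0 i) = p.2 0 i.
Proof.
rewrite /cons_rV mxE; case: fintype.splitP => [j|j] /=.
  by rewrite ord1.
by rewrite /bump /= => -[]; rewrite add0n => /ord_inj ->.
Qed.

Lemma cons_rVP n (x : 'rV[R]_n.+1) (p : R * 'rV[R]_n) :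
  x 0 ord0 = p.1 -> (forall i, x 0 (lift ord0 i) = p.2 0 i) -> x = cons_rV p.
Proof.
move=> h0 hS; apply/rowP => i; have [j ->|->] := unliftP ord0 i.
  by rewrite hS cons_rVS.
by rewrite h0 cons_rV0.
Qed.

Definition tail_rV n (x : 'rV[R]_n.+1) : 'rV[R]_n := \row_i x 0 (lift ord0 i).

Lemma measurable_rVD d (T : measurableType d) n (f g : T -> 'rV[R]_n) :
  measurable_fun setT f -> measurable_fun setT g ->
  measurable_fun setT (fun t => f t + g t).
Proof.
move=> /measurable_fun_coorP mf /measurable_fun_coorP mg.
apply/measurable_fun_coorP => i; under eq_fun do rewrite mxE.
exact: measurable_funD.
Qed.

Lemma measurable_rVN d (T : measurableType d) n (f : T -> 'rV[R]_n) :
  measurable_fun setT f -> measurable_fun setT (fun t => - f t).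
Proof.
move=> /measurable_fun_coorP mf; apply/measurable_fun_coorP => i.
under eq_fun do rewrite mxE.
exact: measurableT_comp.
Qed.

Lemma measurable_sqrtr : measurable_fun setT (@Num.sqrt R).
Proof. by apply: continuous_measurable_fun; exact (@sqrt_continuous R). Qed.

Lemma measurable_enorm n : measurable_fun setT (@enorm R n).
Proof.
apply: (@measurableT_comp _ _ _ _ _ _ (@Num.sqrt R)).
  exact: measurable_sqrtr.
apply: measurable_sum => i; apply: measurable_funX; exact: measurable_coor.
Qed.

Lemma preserving_cons_rV n : preserving
  (@lebesgue_measure R \x lebesgue_rV R n)%E (lebesgue_rV R n.+1) (@cons_rV R n).
Proof. by split => //; exact: measurable_cons_rV. Qed.

Lemma preserving_translate n (a : 'rV[R]_n) :
  preserving (lebesgue_rV R n) (lebesgue_rV R n) (fun x => x + a).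
Proof.
elim: n a => [|n IH] a.
  split; first exact: measurable_rVD.
  by move=> A mA; rewrite (thinmx0 a); congr (_ _); apply/seteqP; split => x /=;
    rewrite addr0.
split; first exact: measurable_rVD.
move=> A mA; have [mc E] := preserving_cons_rV n.
have mt : measurable_fun setT (fun x : 'rV[R]_n.+1 => x + a).
  exact: measurable_rVD.
rewrite !E//; last by rewrite -[X in measurable X]setTI; exact: mt.
have [_ ->] := preserving_prod (lebesgue_measure_translate (a 0 ord0))
  (fun _ => IH (tail_rV a)) (measurable_rVD measurable_snd (measurable_cst _)).
  have Ep p : cons_rV p + a = cons_rV (p.1 + a 0 ord0, p.2 + tail_rV a).
    by apply: cons_rVP => [|i];
      rewrite mxE ?cons_rV0// cons_rVS [RHS]mxE [tail_rV a 0 i]mxE.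
  have PE : @cons_rV R n @^-1` ((fun x => x + a) @^-1` A) =
      (fun p => (p.1 + a 0 ord0, p.2 + tail_rV a)) @^-1` (@cons_rV R n @^-1` A).
    by apply/seteqP; split => p; rewrite /preimage/= Ep.
  by rewrite PE.
by rewrite -[X in measurable X]setTI; exact: mc.
Qed.

End lebesgue_rV_theory.

(** * Square-integrable functions, Euclidean norm and cubes *)

Lemma ler_mul_sqr (R : realDomainType) (a b : R) : a * b <= a ^+ 2 + b ^+ 2.
Proof.
have := sqr_ge0 (a - b); have := sqr_ge0 (a + b).
by rewrite sqrrB sqrrD; nra.
Qed.

Lemma sqrD_le (R : realDomainType) (a b : R) :
  (a + b) ^+ 2 <= 2 * a ^+ 2 + 2 * b ^+ 2.
Proof. by have := sqr_ge0 (a - b); rewrite sqrrB sqrrD; nra. Qed.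

Section square_integrable.
Context d (T : measurableType d) (R : realType).
Variable mu : {measure set T -> \bar R}.
Implicit Types u v w : T -> R.

Definition sqint u :=
  measurable_fun setT u /\ mu.-integrable setT (fun x => (u x ^+ 2)%:E).

Definition l2norm u : R := Num.sqrt (\int[mu]_x (u x ^+ 2)).

Lemma sqint_mul u v :
  sqint u -> sqint v -> mu.-integrable setT (fun x => (u x * v x)%:E).
Proof.
move=> [mu_ iu] [mv iv].
apply: (@le_integrable _ _ _ _ _ measurableT _
  (fun x => (u x ^+ 2)%:E + (v x ^+ 2)%:E)%E); last exact: integrableD.
  by apply/measurable_EFinP; exact: measurable_funM.
move=> x _ /=; rewrite lee_fin normrM [leRHS]ger0_norm ?addr_ge0 ?sqr_ge0//.
rewrite -(real_normK (num_real (u x))) -(real_normK (num_real (v x))).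
exact: ler_mul_sqr.
Qed.

Lemma sqintD u v : sqint u -> sqint v -> sqint (fun x => u x + v x).
Proof.
move=> su sv; have [mu_ iu] := su; have [mv iv] := sv; split.
  exact: measurable_funD.
rewrite (_ : (fun _ => _) = (fun x =>
    ((u x ^+ 2)%:E + (u x * v x)%:E) + ((u x * v x)%:E + (v x ^+ 2)%:E))%E).
  by apply: integrableD => //; apply: integrableD => //; exact: sqint_mul.
by apply/funext => x; rewrite -!EFinD; congr EFin; ring.
Qed.

Lemma sqintZ a u : sqint u -> sqint (fun x => a * u x).
Proof.
move=> [mu_ iu]; split; first exact: measurable_funM.
under eq_fun do rewrite exprMn EFinM.
exact: integrableZl.
Qed.

Lemma sqintB u v : sqint u -> sqint v -> sqint (fun x => u x - v x).
Proof.
move=> su /(sqintZ (-1)) sv; have := sqintD su sv.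
by under eq_fun do rewrite mulN1r.
Qed.

Lemma int_sqr_ge0 u : 0 <= \int[mu]_x (u x ^+ 2).
Proof. by apply: Rintegral_ge0 => x _; exact: sqr_ge0. Qed.

Lemma l2normK u : l2norm u ^+ 2 = \int[mu]_x (u x ^+ 2).
Proof. by rewrite sqr_sqrtr// int_sqr_ge0. Qed.

Lemma l2norm_ge0 u : 0 <= l2norm u.
Proof. exact: sqrtr_ge0. Qed.

Lemma int_sqrD u v (l : R) : sqint u -> sqint v ->
  \int[mu]_x ((u x + l * v x) ^+ 2) =
  \int[mu]_x (u x ^+ 2) + 2 * l * \int[mu]_x (u x * v x) +
  l ^+ 2 * \int[mu]_x (v x ^+ 2).
Proof.
move=> su sv; have iuv := sqint_mul su sv; have [_ iu] := su; have [_ iv] := sv.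
transitivity (\int[mu]_x (u x ^+ 2 + 2 * l * (u x * v x) + l ^+ 2 * v x ^+ 2)).
  by apply: eq_Rintegral => x _; ring.
have i1 : mu.-integrable setT (EFin \o (fun x => 2 * l * (u x * v x))).
  by rewrite /comp; under eq_fun do rewrite EFinM; exact: integrableZl.
rewrite RintegralD//.
- by rewrite RintegralD// !RintegralZl.
- rewrite /comp; under eq_fun do rewrite EFinD; exact: integrableD.
- by rewrite /comp; under eq_fun do rewrite EFinM; exact: integrableZl.
Qed.

(** The polynomial l |-> ||u + l v||^2 is nonnegative; the case ||v|| = 0 is
    separate, as the minimizing l does not exist there. *)
Lemma cauchy_schwarz u v : sqint u -> sqint v ->
  `|\int[mu]_x (u x * v x)| <= l2norm u * l2norm v.
Proof.
move=> su sv; rewrite -(@ler_pXn2r _ 2)// ?nnegrE ?mulr_ge0 ?l2norm_ge0//.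
rewrite exprMn !l2normK real_normK ?num_real//.
have pos l : 0 <= \int[mu]_x (u x ^+ 2) + 2 * l * \int[mu]_x (u x * v x) +
    l ^+ 2 * \int[mu]_x (v x ^+ 2).
  by rewrite -int_sqrD//; exact: int_sqr_ge0.
have := int_sqr_ge0 v; have := int_sqr_ge0 u.
move: pos; set A := Rintegral _ _ _; set B := Rintegral _ _ _.
set C := Rintegral _ _ _ => pos A0; rewrite le_eqVlt => /predU1P[C0|C0].
  have [->|B0] := eqVneq B 0; first by rewrite expr2 mul0r -C0 mulr0.
  (* an l at which the affine function A + 2 l B takes the value -1 *)
  have := pos (- (A + 1) / (2 * B)); rewrite -C0 mulr0 addr0.
  have -> : 2 * (- (A + 1) / (2 * B)) * B = - (A + 1) by field.
  lra.
have := pos (- B / C).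
have -> : A + 2 * (- B / C) * B + (- B / C) ^+ 2 * C = (A * C - B ^+ 2) / C.
  by field; rewrite gt_eqF.
by rewrite pmulr_lge0 ?invr_gt0// subr_ge0.
Qed.

End square_integrable.

Section enorm.
Context (R : realType).

Lemma enorm_ge0 n (x : 'rV[R]_n) : 0 <= enorm x.
Proof. exact: sqrtr_ge0. Qed.

Lemma enorm_sqr n (x : 'rV[R]_n) : enorm x ^+ 2 = \sum_i x 0 i ^+ 2.
Proof. by rewrite sqr_sqrtr// sumr_ge0// => i _; exact: sqr_ge0. Qed.

Lemma enormN n (x : 'rV[R]_n) : enorm (- x) = enorm x.
Proof. by congr Num.sqrt; apply: eq_bigr => i _; rewrite mxE sqrrN. Qed.

Lemma enorm0 n : enorm (0 : 'rV[R]_n) = 0.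
Proof. by rewrite /enorm big1 ?sqrtr0// => i _; rewrite mxE expr0n. Qed.

Lemma enorm0_eq0 n (x : 'rV[R]_n) : enorm x = 0 -> x = 0.
Proof.
move=> x0; apply/rowP => i; rewrite mxE; apply/eqP.
have : \sum_i x 0 i ^+ 2 = 0 by rewrite -enorm_sqr x0 expr0n.
move/eqP; rewrite psumr_eq0 => [|j _]; last exact: sqr_ge0.
by move/allP/(_ i); rewrite mem_index_enum sqrf_eq0; apply.
Qed.

Lemma enorm_cons n (p : R * 'rV[R]_n) :
  enorm (cons_rV p) ^+ 2 = p.1 ^+ 2 + enorm p.2 ^+ 2.
Proof.
rewrite !enorm_sqr big_ord_recl cons_rV0; congr (_ + _).
by apply: eq_bigr => i _; rewrite cons_rVS.
Qed.

(** Coordinatewise, (a + b)^2 <= 2 a^2 + 2 b^2. *)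
Lemma enormD_le2 n (h k : 'rV[R]_n) :
  enorm k <= enorm h -> enorm (h + k) <= 2 * enorm h.
Proof.
move=> kh; rewrite -(@ler_pXn2r _ 2)// ?nnegrE ?mulr_ge0 ?enorm_ge0//.
have {}kh : enorm k ^+ 2 <= enorm h ^+ 2.
  by rewrite ler_pXn2r// nnegrE enorm_ge0.
have : enorm (h + k) ^+ 2 <= 2 * enorm h ^+ 2 + 2 * enorm k ^+ 2.
  rewrite !enorm_sqr !mulr_sumr -big_split/=; apply: ler_sum => i _.
  by rewrite mxE sqrD_le.
by rewrite exprMn; lra.
Qed.

(** Cubes stand in for balls wherever only the order of magnitude of a volume
    matters, since they are products of intervals. *)
Definition cube n (a b : R) : set 'rV[R]_n := [set x | forall i, a <= x 0 i <= b].
Arguments cube : clear implicits.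

Lemma cubeS n a b : @cons_rV R n @^-1` cube n.+1 a b = `[a, b]%classic `*` cube n a b.
Proof.
apply/seteqP; split => p /=.
  move=> h; split; first by have := h ord0; rewrite cons_rV0 in_itv.
  by move=> i; have := h (lift ord0 i); rewrite cons_rVS.
move=> [+ h] i; rewrite in_itv/= => p1; have [j ->|->] := unliftP ord0 i.
  by rewrite cons_rVS.
by rewrite cons_rV0.
Qed.

Lemma measurable_cube n a b : measurable (cube n a b).
Proof.
rewrite (_ : cube n a b = \big[setI/setT]_(i < n)
    ((fun x : 'rV[R]_n => x 0 i) @^-1` `[a, b]%classic)).
  apply: bigsetI_measurable => i _; rewrite -[X in measurable X]setTI.
  exact: measurable_coor.
rewrite -bigcap_seq; apply/seteqP; split => x /= h i.
  by move=> _ /=; rewrite in_itv; exact: h.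
by have := h i; rewrite /= mem_index_enum in_itv/=; exact.
Qed.

Lemma lebesgue_cube n a b : a <= b ->
  lebesgue_rV R n (cube n a b) = ((b - a) ^+ n)%:E.
Proof.
move=> ab; elim: n => [|n IH].
  by rewrite /= /dirac indicE mem_set// => -[].
rewrite (proj2 (preserving_cons_rV R n)) ?cubeS; last exact: measurable_cube.
rewrite product_measure1E//; last exact: measurable_cube.
rewrite [X in (X * _)%E]lebesgue_measure_itv/= lte_fin.
rewrite [X in (_ * X)%E](IH : _ = _) exprS EFinM.
by case: ltgtP ab => // -> _; rewrite subrr mul0e.
Qed.

Lemma enorm_cube n (a b c : R) (x : 'rV[R]_n) : 0 <= c -> - c <= a -> b <= c ->
  cube n a b x -> enorm x <= n%:R * c.
Proof.
move=> c0 ac bc h; rewrite -(@ler_pXn2r _ 2)// ?nnegrE ?mulr_ge0 ?enorm_ge0//.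
rewrite enorm_sqr exprMn (le_trans (y := \sum_(i < n) c ^+ 2))//.
  apply: ler_sum => i _; rewrite -(real_normK (num_real (x 0 i))).
  rewrite ler_pXn2r ?nnegrE// ler_norml; have := h i; lra.
rewrite sumr_const card_ord -[leLHS]mulr_natl ler_wpM2r ?sqr_ge0//.
by rewrite -natrX ler_nat; case: n {x h} => // n; rewrite leq_pmulr.
Qed.

Lemma ball_sub_cube n (r : R) (x : 'rV[R]_n) : enorm x <= r -> cube n (- r) r x.
Proof.
move=> xr i; rewrite -ler_norml (le_trans _ xr)//.
rewrite -(@ler_pXn2r _ 2)// ?nnegrE ?enorm_ge0// real_normK ?num_real// enorm_sqr.
by rewrite (bigD1 i)//= lerDl sumr_ge0// => j _; exact: sqr_ge0.
Qed.

End enorm.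
Arguments cube {R}.

(** * The modulus of continuity in mean square *)

(** The real-valued integral is a measurable function of the integrals of the
    positive and the negative part, whether or not these are finite. *)
Lemma measurable_Rintegral_l d1 d2 (T1 : measurableType d1)
    (T2 : measurableType d2) (R : realType)
    (m1 : {sigma_finite_measure set T1 -> \bar R}) (f : T1 * T2 -> R) :
  measurable_fun setT f ->
  measurable_fun setT (fun y => \int[m1]_x f (x, y)).
Proof.
move=> mf; have mF : measurable_fun setT (EFin \o f) by exact/measurable_EFinP.
apply: (@measurableT_comp _ _ _ _ _ _ (@fine R)).
  exact: fine_measurable.
rewrite (_ : (fun _ => _) = (fubini_G m1 (EFin \o f)^\+ \-
    fubini_G m1 (EFin \o f)^\-)%E); last first.
  by apply/funext => y; rewrite integralE; congr (_ - _)%E;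
    apply: eq_integral => x _; rewrite ?funeposE ?funenegE.
apply: emeasurable_funB.
  by apply: measurable_fun_fubini_tonelli_G => //; exact: measurable_funepos.
by apply: measurable_fun_fubini_tonelli_G => //; exact: measurable_funeneg.
Qed.

Section translates.
Context (R : realType) (n : nat).
Local Notation leb := (lebesgue_rV R n).
Implicit Types (u v : 'rV[R]_n -> R) (h k : 'rV[R]_n).

Lemma preserving_shear :
  preserving (leb \x leb)%E (leb \x leb)%E (fun p => (p.1, p.1 + p.2)).
Proof.
rewrite (_ : (fun _ => _) = (fun p : 'rV[R]_n * 'rV[R]_n => (p.1, p.2 + p.1))).
  apply: (@preserving_prod _ _ _ _ R leb leb id (fun x y => y + x)).
  - by split.
  - exact: preserving_translate.
  - exact: measurable_rVD measurable_snd measurable_fst.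
by apply/funext => p; rewrite addrC.
Qed.

Lemma measurable_translate v h : measurable_fun setT v ->
  measurable_fun setT (fun x : 'rV[R]_n => v (x + h)).
Proof.
by move=> mv; exact: measurableT_comp mv (proj1 (preserving_translate h)).
Qed.

Lemma int_translate v h : measurable_fun setT v ->
  \int[leb]_x v (x + h) = \int[leb]_x v x.
Proof.
by move=> mv; rewrite [RHS](Rintegral_preserving (preserving_translate h)).
Qed.

Lemma sqint_translate v h : sqint leb v -> sqint leb (fun x => v (x + h)).
Proof.
move=> [mv iv]; split; first exact: measurable_translate.
have mv2 : measurable_fun setT (fun x => (v x ^+ 2)%:E).
  by apply/measurable_EFinP; exact: measurable_funX.
exact: (integrable_preserving (preserving_translate h) mv2).1 iv.
Qed.

Lemma l2norm_translate v h : sqint leb v ->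
  l2norm leb (fun x => v (x + h)) = l2norm leb v.
Proof.
move=> [mv _]; congr Num.sqrt.
by rewrite (int_translate (v := fun x => v x ^+ 2))//; exact: measurable_funX.
Qed.

(** The squared L^2 modulus of continuity. *)
Definition sqmodulus v h := \int[leb]_x ((v x - v (x + h)) ^+ 2).

Lemma sqmodulus_ge0 v h : 0 <= sqmodulus v h.
Proof. exact: int_sqr_ge0. Qed.

Lemma sqmodulus0 v : sqmodulus v 0 = 0.
Proof.
rewrite /sqmodulus; under eq_Rintegral do rewrite addr0 subrr expr0n.
by rewrite Rintegral_cst// mul0r.
Qed.

Lemma sqint_diff v h : sqint leb v -> sqint leb (fun x => v x - v (x + h)).
Proof. by move=> sv; apply: sqintB => //; exact: sqint_translate. Qed.

(** Parallelogram-type inequality for v - v(. + h), written as the difference of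
    v - v(. + h + k) and of the translate by h of v - v(. + k). *)
Lemma sqmodulusD v h k : sqint leb v ->
  sqmodulus v h <= 2 * sqmodulus v (h + k) + 2 * sqmodulus v k.
Proof.
move=> sv; rewrite [sqmodulus v k]/sqmodulus.
rewrite -(int_translate (v := fun x => (v x - v (x + k)) ^+ 2) h); last first.
  by apply: measurable_funX; have [] := sqint_diff k sv.
have [_ i1] := sqint_diff (h + k) sv.
have [_ i2] := sqint_translate h (sqint_diff k sv).
have [_ i3] := sqint_diff h sv.
rewrite -RintegralZl// -RintegralZl// -RintegralD//.
- apply: le_Rintegral => //.
    rewrite /comp; under eq_fun do rewrite EFinD !EFinM.
    by apply: integrableD => //; apply: integrableZl.
  move=> x _; rewrite addrA.
  move: (v x) (v (x + h)) (v (x + h + k)) => a b c.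
  have -> : a - b = (a - c) + (c - b) by ring.
  by apply: (le_trans (sqrD_le _ _)); rewrite -(opprB b c) sqrrN.
- by rewrite /comp; under eq_fun do rewrite EFinM; apply: integrableZl.
- by rewrite /comp; under eq_fun do rewrite EFinM; apply: integrableZl.
Qed.

Lemma measurable_sqmodulus v : measurable_fun setT v ->
  measurable_fun setT (sqmodulus v).
Proof.
move=> mv; apply: (@measurable_Rintegral_l _ _ _ _ _ _
  (fun p => (v p.1 - v (p.1 + p.2)) ^+ 2)).
apply: measurable_funX; apply: measurable_funB.
  exact: measurableT_comp mv measurable_fst.
exact: measurableT_comp mv (measurable_rVD measurable_fst measurable_snd).
Qed.

Lemma measurable_enorm_powR p :
  measurable_fun setT (fun h : 'rV[R]_n => enorm h `^ p).
Proof. exact: measurableT_comp (measurable_powR p) (@measurable_enorm R n). Qed.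

Lemma measurable_enorm_powRV p :
  measurable_fun setT (fun h : 'rV[R]_n => (enorm h `^ p)^-1).
Proof. by under eq_fun do rewrite -powRN; exact: measurable_enorm_powR. Qed.

(** After the shear, integrating first in x turns the squared seminorm into a
    weighted integral of the modulus. *)
Lemma gagliardo_sqmodulus t v : sqint leb v ->
  (gagliardo_seminorm t v < +oo)%E ->
  (\int[leb]_h (sqmodulus v h / enorm h `^ (n%:R + 2 * t))%:E < +oo)%E.
Proof.
move=> sv; have [mv iv] := sv; rewrite /gagliardo_seminorm.
set I := integral _ _ _ => Ioo; have : (I < +oo)%E.
  by apply: lty_poweRy Ioo; rewrite invr_neq0.
congr (_ < _)%E; rewrite /I.
have mK : measurable_fun setT (fun z : 'rV[R]_n * 'rV[R]_n =>
    ((v z.1 - v z.2) ^+ 2 / enorm (z.1 - z.2) `^ (n%:R + 2 * t))%:E).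
  apply/measurable_EFinP; apply: measurable_funM.
    apply: measurable_funX; apply: measurable_funB.
      exact: measurableT_comp mv measurable_fst.
    exact: measurableT_comp mv measurable_snd.
  apply: (measurableT_comp (measurable_enorm_powRV _)).
  exact: measurable_rVD measurable_fst (measurable_rVN measurable_snd).
have K0 z : (0 <= ((v z.1 - v z.2) ^+ 2 /
    enorm (z.1 - z.2) `^ (n%:R + 2 * t))%:E)%E.
  by rewrite lee_fin mulr_ge0 ?sqr_ge0 ?invr_ge0 ?powR_ge0.
rewrite (ge0_integral_preserving preserving_shear mK)//.
rewrite fubini_tonelli2/=; last 2 first.
- exact: measurableT_comp mK (proj1 preserving_shear).
- by move=> z; exact: (K0 (z.1, z.1 + z.2)).
apply: eq_integral => h _; rewrite /fubini_G/=.
have [md idh] := sqint_diff h sv.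
under eq_integral do rewrite opprD addrA subrr add0r enormN EFinM.
rewrite ge0_integralZr//.
- by rewrite EFinM fineK//; exact: integrable_fin_num.
- by apply/measurable_EFinP; exact: measurable_funX.
- by move=> x _; rewrite lee_fin sqr_ge0.
- by rewrite lee_fin invr_ge0 powR_ge0.
Qed.

End translates.

(** Averaging over [K], and enlarging both domains of integration to the whole
    space. *)
Lemma le_measure_translate_sum (R : realType) n (q : 'rV[R]_n -> R) (h : 'rV[R]_n)
    (K : set 'rV[R]_n) (a A : R)
    (m := \int[lebesgue_rV R n]_k q k) :
  measurable_fun setT q -> (forall k, 0 <= q k) ->
  (\int[lebesgue_rV R n]_k (q k)%:E < +oo)%E -> measurable K ->
  0 <= a -> 0 <= A -> (forall k, K k -> a <= A * (q (k + h) + q k)) ->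
  (a%:E * lebesgue_rV R n K <= (A * (m + m))%:E)%E.
Proof.
move=> mq q0 qoo mK a0 A0 Kle.
have mqE : measurable_fun setT (EFin \o q) by exact/measurable_EFinP.
have qE0 k : (0 <= (EFin \o q) k)%E by rewrite lee_fin.
have ME : (\int[lebesgue_rV R n]_k (q k)%:E = m%:E)%E.
  rewrite /m /Rintegral fineK// ge0_fin_numE//.
  by apply: integral_ge0 => k _; exact: qE0.
have mqh : measurable_fun setT (fun k : 'rV[R]_n => q (k + h)).
  exact: measurable_translate.
have mqhE : measurable_fun setT (fun k : 'rV[R]_n => (q (k + h))%:E).
  exact/measurable_EFinP.
have mD := measurable_funD mqh mq.
have mDE : measurable_fun setT (fun k : 'rV[R]_n => (q (k + h) + q k)%:E).
  by apply/measurable_EFinP.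
have D0 k : (0 <= (q (k + h) + q k)%:E)%E by rewrite lee_fin addr_ge0.
rewrite -integral_cst//.
apply: (@le_trans _ _
    (\int[lebesgue_rV R n]_(k in K) (A%:E * (q (k + h) + q k)%:E))%E).
  apply: ge0_le_integral => //.
  by apply: measurable_funTS; exact: measurable_funeM.
rewrite ge0_integralZl//; last exact: measurable_funTS.
rewrite EFinM lee_wpmul2l// EFinD -ME.
apply: (@le_trans _ _ (\int[lebesgue_rV R n]_k (q (k + h) + q k)%:E)%E).
  by apply: ge0_subset_integral.
under eq_integral do rewrite EFinD.
rewrite ge0_integralD//; last by move=> k _; exact: qE0.
by rewrite -(ge0_integral_preserving (preserving_translate h) mqE).
by move=> k _; exact: (qE0 (k + h)).
Qed.

(** With k in a cube of side |h| / N, both k and h + k have norm at most 2 |h|,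
    so there Q <= (2 |h|)^p q with q = Q / |.|^p and p = N + 2t.  Averaging
    Q(h) <= 2 Q(h + k) + 2 Q(k) gives |h|^N Q(h) = O(|h|^p), the integral of q
    being finite. *)
Lemma sqmodulus_holder (R : realType) n (t : R) (v : 'rV[R]_n.+1 -> R) : 0 < t ->
  sqint (lebesgue_rV R n.+1) v -> (gagliardo_seminorm t v < +oo)%E ->
  exists C : R, forall h, sqmodulus v h <= C * enorm h `^ (2 * t).
Proof.
move=> t0 sv vt; have [mv _] := sv.
set p : R := n.+1%:R + 2 * t.
have p0 : 0 < p by rewrite addr_gt0 ?mulr_gt0.
pose q h := sqmodulus v h / enorm h `^ p.
have q0 h : 0 <= q h by rewrite mulr_ge0 ?sqmodulus_ge0 ?invr_ge0 ?powR_ge0.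
have mq : measurable_fun setT q.
  by apply: measurable_funM; [exact: measurable_sqmodulus|];
    exact: measurable_enorm_powRV.
have := gagliardo_sqmodulus sv vt; rewrite -/p.
rewrite -[X in (X < _)%E]/(integral _ _ (EFin \o q)) => qoo.
pose m := \int[lebesgue_rV R n.+1]_k q k.
pose N : R := n.+1%:R.
exists (4 * 2 `^ p * N ^+ n.+1 * m) => h.
have [h0|h0] := eqVneq h 0.
  by rewrite h0 sqmodulus0 enorm0 powR0 ?mulr0// mulf_neq0 ?gt_eqF.
have r0 : 0 < enorm h.
  by rewrite lt_def enorm_ge0 andbT; apply: contra_neq h0; exact: enorm0_eq0.
have N0 : 0 < N by rewrite ltr0n.
have qle k : enorm k <= 2 * enorm h ->
    sqmodulus v k <= (2 * enorm h) `^ p * q k.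
  move=> kh; have [->|k0] := eqVneq k 0.
    by rewrite sqmodulus0 mulr_ge0 ?powR_ge0.
  have rk : 0 < enorm k.
    by rewrite lt_def enorm_ge0 andbT; apply: contra_neq k0; exact: enorm0_eq0.
  rewrite mulrCA ler_peMr ?sqmodulus_ge0// ler_pdivlMr ?powR_gt0// mul1r.
  by rewrite ge0_ler_powR ?nnegrE ?(ltW p0) ?mulr_ge0 ?enorm_ge0.
(* a cube contained in the ball of radius |h| *)
pose K := cube n.+1 0 (enorm h / N).
have mK : measurable K by exact: measurable_cube.
have Kh k : K k -> enorm k <= enorm h.
  move=> /enorm_cube; move=> /(_ (enorm h / N)); rewrite -/N mulrCA divff ?gt_eqF//.
  by rewrite mulr1; apply => //; rewrite ?oppr_le0 divr_ge0 ?ltW.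
pose A := 2 * (2 * enorm h) `^ p.
have A0 : 0 <= A by rewrite mulr_ge0 ?powR_ge0.
have := le_measure_translate_sum (h := h) mq q0 qoo mK (sqmodulus_ge0 v h) A0.
have -> : lebesgue_rV R n.+1 K = ((enorm h / N) ^+ n.+1)%:E.
  by rewrite /K lebesgue_cube ?divr_ge0 ?ltW// subr0.
have le2 k : K k -> sqmodulus v h <= A * (q (k + h) + q k).
  move=> /Kh kh; apply: (le_trans (sqmodulusD h k sv)).
  rewrite /A -mulrA -mulrDr ler_pM2l//.
  rewrite mulrDr [k + h]addrC lerD// qle ?enormD_le2//.
  by rewrite (le_trans kh)// ler_peMl ?enorm_ge0// ler1n.
move=> /(_ le2); rewrite -EFinM lee_fin -/m /A powRM ?enorm_ge0//.
have -> : enorm h `^ p = enorm h ^+ n.+1 * enorm h `^ (2 * t).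
  by rewrite /p powRD ?gt_eqF ?implybT// powR_mulrn ?enorm_ge0.
set r := enorm h; set c := 2 `^ p; set e := r `^ (2 * t).
set X := (X in _ <= X -> _) => le1.
have {}le1 : sqmodulus v h * r ^+ n.+1 <= X * N ^+ n.+1.
  by rewrite -ler_pdivrMr ?exprn_gt0// -mulrA -expr_div_n.
rewrite -(@ler_pM2r _ (r ^+ n.+1)) ?exprn_gt0//; apply: le_trans le1 _.
by rewrite le_eqVlt /X; apply/orP; left; apply/eqP; ring.
Qed.

(** * The increment form *)

Lemma holder_continuous_at (R : realType) (f : R -> R) (D e x : R) : 0 < e ->
  (forall y, `|f x - f y| <= D * `|x - y| `^ e) -> f y @[y --> x] --> f x.
Proof.
move=> e0 fD; apply/cvgrPdist_le => eps eps0.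
(* rho^e (|D| + 1) = eps; the summand 1 covers D = 0 *)
pose rho := (eps / (`|D| + 1)) `^ e^-1.
have D0 : 0 < `|D| + 1 by rewrite ltr_wpDl.
have rho0 : 0 < rho by rewrite powR_gt0// divr_gt0.
near=> y; apply: (le_trans (fD y)).
apply: (@le_trans _ _ ((`|D| + 1) * `|x - y| `^ e)).
  rewrite ler_wpM2r ?powR_ge0//; apply: le_trans (ler_norm _) _.
  by rewrite lerDl.
rewrite -ler_pdivlMl// mulrC (_ : _ / _ = rho `^ e); last first.
  by rewrite -powRrM mulVf ?gt_eqF// powRr1// divr_ge0// ltW.
rewrite ge0_ler_powR ?nnegrE ?(ltW e0)// ?(ltW rho0)//.
Unshelve. all: by end_near. Qed.

Section increments.
Context (R : realType) (n : nat).
Local Notation leb := (lebesgue_rV R n).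
Implicit Types (u v : 'rV[R]_n -> R) (h k : 'rV[R]_n).

Definition correlation u v h := \int[leb]_x (u x * v (x + h)).

Definition increment_form u v h :=
  \int[leb]_x ((u x - u (x + h)) * (v x - v (x + h))).

Lemma measurable_increment_form u v :
  measurable_fun setT u -> measurable_fun setT v ->
  measurable_fun setT (increment_form u v).
Proof.
move=> mu mv; have m (w : 'rV[R]_n -> R) : measurable_fun setT w ->
    measurable_fun setT (fun p : 'rV[R]_n * 'rV[R]_n => w p.1 - w (p.1 + p.2)).
  move=> mw; apply: measurable_funB.
    exact: measurableT_comp mw measurable_fst.
  exact: measurableT_comp mw (measurable_rVD measurable_fst measurable_snd).
apply: (@measurable_Rintegral_l _ _ _ _ _ _
  (fun p => (u p.1 - u (p.1 + p.2)) * (v p.1 - v (p.1 + p.2)))).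
by apply: measurable_funM; exact: m.
Qed.

Lemma l2norm_increment v h : sqint leb v ->
  l2norm leb (fun x => v x - v (x + h)) <= 2 * l2norm leb v.
Proof.
move=> sv; rewrite -(@ler_pXn2r _ 2)// ?nnegrE ?mulr_ge0 ?l2norm_ge0//.
have svh := sqint_translate h sv; have [_ i1] := sv; have [_ i2] := svh.
have [_ i3] := sqint_diff h sv.
have EN := l2norm_translate h sv.
rewrite exprMn [2 ^+ 2](_ : _ = 2 + 2); last by ring.
rewrite mulrDl -{2}EN !l2normK -!RintegralZl//.
rewrite -RintegralD//; last 2 first.
- by rewrite /comp; under eq_fun do rewrite EFinM; apply: integrableZl.
- by rewrite /comp; under eq_fun do rewrite EFinM; apply: integrableZl.
apply: le_Rintegral => //.
  rewrite /comp; under eq_fun do rewrite EFinD !EFinM.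
  by apply: integrableD => //; apply: integrableZl.
by move=> x _; rewrite -[X in _ <= _ + 2 * X]sqrrN sqrD_le.
Qed.

Lemma increment_form_le u v h : sqint leb u -> sqint leb v ->
  `|increment_form u v h| <= 4 * l2norm leb u * l2norm leb v.
Proof.
move=> su sv.
apply: (le_trans (cauchy_schwarz (sqint_diff h su) (sqint_diff h sv))).
have := ler_pM (l2norm_ge0 _ _) (l2norm_ge0 _ _)
  (l2norm_increment h su) (l2norm_increment h sv).
by move/le_trans; apply; rewrite le_eqVlt; apply/orP; left; apply/eqP; ring.
Qed.

(** Expand the product; translating the variable of integration moves all the
    shifts onto v. *)
Lemma increment_form_correlation u v h : sqint leb u -> sqint leb v ->
  increment_form u v h =
  2 * correlation u v 0 - correlation u v h - correlation u v (- h).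
Proof.
move=> su sv; have suh := sqint_translate h su; have svh := sqint_translate h sv.
have [mu _] := su; have [mv _] := sv.
have [muh _] := suh; have [mvh _] := svh.
have i1 := sqint_mul su sv; have i2 := sqint_mul suh svh.
have i3 := sqint_mul su svh; have i4 := sqint_mul suh sv.
have i12 : leb.-integrable setT
    (EFin \o (fun x => u (x + h) * v (x + h) + u x * v x)).
  exact: (integrableD measurableT i2 i1).
have i123 : leb.-integrable setT (EFin \o
    (fun x => u (x + h) * v (x + h) + u x * v x - u x * v (x + h))).
  exact: (integrableB measurableT i12 i3).
have E1 : \int[leb]_x (u (x + h) * v (x + h)) = correlation u v 0.
  rewrite (int_translate (v := fun x => u x * v x)); last exact: measurable_funM.
  by apply: eq_Rintegral => x _; rewrite addr0.
have E2 : \int[leb]_x (u (x + h) * v x) = correlation u v (- h).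
  rewrite -(int_translate (v := fun x => u (x + h) * v x) (- h)).
    by apply: eq_Rintegral => x _; rewrite subrK.
  exact: measurable_funM.
have E3 : \int[leb]_x (u x * v x) = correlation u v 0.
  by apply: eq_Rintegral => x _; rewrite addr0.
rewrite mulr_natl mulr2n -{1}E1 -E3 -E2 [correlation u v h]/correlation.
rewrite -(RintegralD measurableT i2 i1) -(RintegralB measurableT i12 i3).
rewrite -(RintegralB measurableT i123 i4).
by apply: eq_Rintegral => x _; ring.
Qed.

(** Cauchy-Schwarz against u; the two translates of v differ by the shift k - h. *)
Lemma correlation_dist u v h k : sqint leb u -> sqint leb v ->
  `|correlation u v h - correlation u v k| <=
  l2norm leb u * Num.sqrt (sqmodulus v (k - h)).
Proof.
move=> su sv; have svh := sqint_translate h sv; have svk := sqint_translate k sv.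
rewrite -RintegralB//; [|exact: sqint_mul|exact: sqint_mul].
under eq_Rintegral do rewrite -mulrBr.
apply: (le_trans (cauchy_schwarz su (sqintB svh svk))).
rewrite le_eqVlt; apply/orP; left; apply/eqP; congr (_ * Num.sqrt _).
rewrite /sqmodulus.
rewrite -(int_translate (v := fun x => (v x - v (x + (k - h))) ^+ 2) h).
  by apply: eq_Rintegral => x _; rewrite -addrA [h + _]addrC subrK.
by apply: measurable_funX; have [] := sqint_diff (k - h) sv.
Qed.

End increments.

Lemma increment_form_holder (R : realType) n (t : R) (u v : 'rV[R]_n.+1 -> R) :
  0 < t -> sqint (lebesgue_rV R n.+1) u -> sqint (lebesgue_rV R n.+1) v ->
  (gagliardo_seminorm t v < +oo)%E ->
  exists D : R, forall h k,
    `|increment_form u v h - increment_form u v k| <= D * enorm (h - k) `^ t.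
Proof.
move=> t0 su sv /(sqmodulus_holder t0 sv)[C QC].
exists (2 * (l2norm (lebesgue_rV R n.+1) u * Num.sqrt `|C|)) => h k.
have sq w : Num.sqrt (sqmodulus v w) <= Num.sqrt `|C| * enorm w `^ t.
  rewrite (_ : enorm w `^ t = Num.sqrt (enorm w `^ (2 * t))); last first.
    by rewrite -powR12_sqrt ?powR_ge0// -powRrM mulrAC divff ?mul1r.
  rewrite -sqrtrM// ler_sqrt ?mulr_ge0 ?powR_ge0//.
  by apply: (le_trans (QC w)); rewrite ler_wpM2r ?powR_ge0// ler_norm.
rewrite !increment_form_correlation//.
have e1 := correlation_dist k h su sv.
have e2 := correlation_dist (- k) (- h) su sv.
have -> : 2 * correlation u v 0 - correlation u v h - correlation u v (- h) -
    (2 * correlation u v 0 - correlation u v k - correlation u v (- k)) =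
    (correlation u v k - correlation u v h) +
    (correlation u v (- k) - correlation u v (- h)) by ring.
apply: (le_trans (ler_normD _ _)); rewrite -!mulrA mulr_natl mulr2n.
apply: lerD.
  by apply: (le_trans e1); rewrite ler_wpM2l ?l2norm_ge0.
apply: (le_trans e2); rewrite ler_wpM2l ?l2norm_ge0//.
by rewrite -(enormN (h - k)) opprB -[- h - - k](_ : k - h = _) // opprK addrC.
Qed.

Lemma increment_form_continuous (R : realType) n (t : R)
    (u v : 'rV[R]_n.+1 -> R) (c : R) z (x : R) :
  0 < t -> sqint (lebesgue_rV R n.+1) u -> sqint (lebesgue_rV R n.+1) v ->
  (gagliardo_seminorm t v < +oo)%E -> `|c| = 1 ->
  increment_form u v (cons_rV (c * y, z)) @[y --> x] -->
  increment_form u v (cons_rV (c * x, z)).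
Proof.
move=> t0 su sv tv c1; have [D gD] := increment_form_holder t0 su sv tv.
apply: (@holder_continuous_at _
  (fun y => increment_form u v (cons_rV (c * y, z))) D t) => // y.
apply: le_trans (gD _ _) _; rewrite le_eqVlt; apply/orP; left; apply/eqP.
congr (_ * _ `^ _).
have -> : cons_rV (c * x, z) - cons_rV (c * y, z) = cons_rV (c * (x - y), 0).
  apply: cons_rVP => [|i]; rewrite mxE [X in _ + X]mxE ?cons_rV0 ?cons_rVS/=.
    by rewrite mulrBr.
  by rewrite subrr mxE.
apply/eqP; rewrite -(@eqrXn2 _ 2) ?enorm_ge0// enorm_cons/= enorm0 expr0n addr0.
rewrite exprMn -[c ^+ 2]real_normK ?num_real// c1.
by rewrite expr1n mul1r real_normK ?num_real.
Qed.

(** * Heights over a sphere and volumes of shells *)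

Section inverse_sqrt_integral.
Context (R : realType).
Notation mu := (@lebesgue_measure R).

Let f (c t : R) : R := (Num.sqrt (c ^+ 2 - t ^+ 2))^-1.

Let G (c x : R) : R := asin (x / c).

Lemma sqr_lt_sub_gt0 (b c t : R) : 0 < c -> b < c -> t \in `[- b, b] ->
  0 < c ^+ 2 - t ^+ 2.
Proof.
move=> c0 bc; rewrite in_itv/= -ler_norml => tb.
by rewrite subr_gt0 -(real_normK (num_real t)) ltr_pXn2r ?nnegrE ?(ltW c0)//;
  exact: le_lt_trans tb bc.
Qed.

Lemma is_derive_asin_div (c t : R) : 0 < c -> 0 < c ^+ 2 - t ^+ 2 ->
  is_derive t 1 (G c) (f c t).
Proof.
move=> c0 ct.
have tc : -1 < t / c < 1.
  rewrite -ltr_norml normrM normfV (gtr0_norm c0) ltr_pdivrMr// mul1r.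
  by rewrite -(@ltr_pXn2r _ 2) ?nnegrE ?(ltW c0)// real_normK ?num_real// -subr_gt0.
have d1 : is_derive (t : R) (1 : R) (c^-1 \*: (@id R)) (c^-1 *: (1 : R)).
  exact: is_deriveZ.
have d2 : is_derive ((c^-1 \*: (@id R)) t) (1 : R) (@asin R)
    (Num.sqrt (1 - (t / c) ^+ 2))^-1.
  by rewrite [(_ \*: _) t]mulrC; exact: is_derive1_asin.
have := is_derive1_comp d2 d1.
rewrite (_ : _ \o _ = G c); last first.
  by apply/funext => x; rewrite /G /=; rewrite [_ *: _]mulrC.
congr is_derive; rewrite /f [_ *: _]mulr1.
rewrite [X in _ * X](_ : c^-1 = (Num.sqrt (c ^+ 2))^-1); last first.
  by rewrite sqrtr_sqr gtr0_norm.
rewrite -invfM -sqrtrM; last first.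
  rewrite subr_ge0 -(real_normK (num_real (t / c))) expr_le1//.
  by rewrite ltW// ltr_norml.
by congr (Num.sqrt _)^-1; field; rewrite gt_eqF.
Qed.

Lemma integral_inverse_sqrt_itv (b c : R) : 0 < b -> b < c ->
  (\int[mu]_(t in `[(- b)%R, b]) (f c t)%:E <= pi%:E)%E.
Proof.
move=> b0 bc; have c0 := lt_trans b0 bc.
have fd t : t \in `[- b, b] -> is_derive t 1 (G c) (f c t).
  by move=> tb; apply: is_derive_asin_div => //; exact: sqr_lt_sub_gt0 tb.
have Fc t : t \in `[- b, b] -> {for t, continuous (G c)}.
  move=> /fd tb; apply/differentiable_continuous/derivable1_diffP.
  exact: (@ex_derive _ _ _ _ _ _ _ tb).
rewrite (@continuous_FTC2 _ (f c) (G c) (- b) b).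
- have bc1 : -1 <= b / c <= 1.
    rewrite ler_pdivrMr// mul1r (ltW bc) andbT.
    by rewrite (le_trans (y := 0)) ?lerN10 ?divr_ge0 ?ltW.
  have bc2 : -1 <= - b / c <= 1 by rewrite mulNr lerN2 lerNl andbC.
  rewrite -EFinB lee_fin /G.
  have := asin_lepi2 bc1; have := asin_geNpi2 bc2; lra.
- by lra.
- apply: continuous_in_subspaceT => t /set_mem/= tb.
  have ct := sqr_lt_sub_gt0 c0 bc tb.
  apply: cvgV; first by rewrite gt_eqF// sqrtr_gt0.
  apply: continuous_cvg; first exact (@sqrt_continuous R _).
  apply: cvgB; first exact: cvg_cst.
  exact: exprn_continuous.
- split.
  + move=> t /subset_itv_oo_cc /fd tb; exact: (@ex_derive _ _ _ _ _ _ _ tb).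
  + apply: cvg_at_right_filter; apply: Fc.
    by rewrite in_itv/= lexx/=; lra.
  + apply: cvg_at_left_filter; apply: Fc.
    by rewrite in_itv/= lexx andbT; lra.
- move=> t /subset_itv_oo_cc /fd tb; rewrite derive1E.
  exact: (@derive_val _ _ _ _ _ _ _ tb).
Qed.

Lemma measurable_sqrtrV d (T : measurableType d) (g : T -> R) :
  measurable_fun setT g -> measurable_fun setT (fun x => (Num.sqrt (g x))^-1).
Proof.
move=> mg; under eq_fun do rewrite -powR_inv1 ?sqrtr_ge0//.
apply: (@measurableT_comp _ _ _ _ _ _ (fun y => y `^ (-1))).
  exact: measurable_powR.
apply: (@measurableT_comp _ _ _ _ _ _ (@Num.sqrt R)); last exact: mg.
exact: measurable_sqrtr.
Qed.

(** The integrand is singular at both ends of its support ]-c, c[, so the arcsine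
    primitive is used on the compact intervals [- b i, b i], which exhaust ]-c, c[.
    Outside, the square root of a negative number and the inverse of 0 are 0. *)
Lemma integral_inverse_sqrt (a : R) :
  (\int[mu]_t ((Num.sqrt (a - t ^+ 2))^-1)%:E <= pi%:E)%E.
Proof.
have [a0|a0] := leP a 0.
  rewrite integral0_eq ?lee_fin ?pi_ge0// => t _.
  by rewrite ler0_sqrtr ?invr0// subr_le0 (le_trans a0)// sqr_ge0.
pose c := Num.sqrt a; have c0 : 0 < c by rewrite sqrtr_gt0.
have -> : a = c ^+ 2 by rewrite sqr_sqrtr// ltW.
(* 0 < b i < c, increasing to c; the index is shifted by 2 so that b 0 > 0 *)
pose b (i : nat) : R := c * (1 - i.+2%:R^-1).
have b0 i : 0 < b i by rewrite mulr_gt0// subr_gt0 invf_lt1 ?ltr0n// ltr1n.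
have bc i : b i < c by rewrite gtr_pMr// ltrBlDr ltrDl invr_gt0 ltr0n.
pose F i : set R := [set` `[- b i, b i]].
have mf : measurable_fun setT (fun t => (f c t)%:E).
  apply/measurable_EFinP; apply: measurable_sqrtrV.
  by apply: measurable_funB => //; exact: measurable_funX.
have f0 t : (0 <= (f c t)%:E)%E by rewrite lee_fin invr_ge0 sqrtr_ge0.
have ndF : nondecreasing_seq F.
  move=> i j ij; apply/subsetPset => t; rewrite /F /= !in_itv/= -!ler_norml.
  move=> /le_trans; apply; rewrite ler_pM2l// lerD2l lerN2 lef_pV2 ?posrE ?ltr0n//.
  by rewrite ler_nat !ltnS.
have UF : (\int[mu]_t (f c t)%:E = \int[mu]_(t in \bigcup_i F i) (f c t)%:E)%E.
  rewrite [RHS]integral_mkcond; apply: eq_integral => t _.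
  rewrite /patch; case: ifPn => // tF; congr EFin; apply/eqP.
  rewrite /f invr_eq0 sqrtr_eq0 subr_le0.
  rewrite -(real_normK (num_real t)) ler_pXn2r ?nnegrE ?(ltW c0)//.
  rewrite leNgt; apply: contra tF => tc; apply/mem_set.
  pose e := 1 - `|t| / c.
  have e0 : 0 < e by rewrite subr_gt0 ltr_pdivrMr// mul1r.
  exists (Num.truncn e^-1) => //; rewrite /F /= in_itv/= -ler_norml /b.
  rewrite -ler_pdivrMl// mulrC lerBrDr -lerBrDl -/e.
  rewrite -[leRHS]invrK lef_pV2 ?posrE ?ltr0n ?invr_gt0//.
  apply/ltW; apply: lt_le_trans (truncnS_gt _) _.
  by rewrite ler_nat.
have cv : (\int[mu]_(t in F i) (f c t)%:E @[i --> \oo] -->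
    \int[mu]_(t in \bigcup_i F i) (f c t)%:E)%E.
  apply: ge0_nondecreasing_set_cvg_integral => //.
  - by move=> i; exact: measurable_itv.
  - by move=> i; exact: measurable_funTS.
rewrite UF -(cvg_lim _ cv)//; apply: lime_le.
  by apply/cvg_ex; eexists; exact: cv.
by apply: nearW => i; exact: integral_inverse_sqrt_itv.
Qed.

End inverse_sqrt_integral.

Section height.
Context (R : realType).

(** The hemispheres of radius r are the graphs of [height r] and of its opposite
    over the ball of radius r; off that ball the height, hence also its inverse,
    is 0, so integrals of its inverse need no restriction to the ball. *)
Definition height n (r : R) (z : 'rV[R]_n) := Num.sqrt (r ^+ 2 - enorm z ^+ 2).

Lemma height_ge0 n r (z : 'rV[R]_n) : 0 <= height r z.
Proof. exact: sqrtr_ge0. Qed.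

Lemma height_cons n r t (z : 'rV[R]_n) :
  height r (cons_rV (t, z)) = Num.sqrt ((r ^+ 2 - enorm z ^+ 2) - t ^+ 2).
Proof. by rewrite /height enorm_cons /=; congr Num.sqrt; ring. Qed.

Lemma ler_height n (r r' : R) (z : 'rV[R]_n) : 0 <= r -> r <= r' ->
  height r z <= height r' z.
Proof.
move=> r0 rr'; apply: ler_wsqrtr; rewrite lerD2r ler_pXn2r// nnegrE.
exact: le_trans rr'.
Qed.

Lemma height_gt0 n (r : R) (z : 'rV[R]_n) : enorm z < r -> 0 < height r z.
Proof.
move=> zr; rewrite sqrtr_gt0 subr_gt0 ltr_pXn2r// nnegrE ?enorm_ge0//.
exact: le_trans (enorm_ge0 z) (ltW zr).
Qed.

Lemma height_eq0 n (r : R) (z : 'rV[R]_n) : 0 <= r -> r <= enorm z ->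
  height r z = 0.
Proof.
move=> r0 zr; apply: ler0_sqrtr.
by rewrite subr_le0 ler_pXn2r// nnegrE ?enorm_ge0.
Qed.

(** For t > 0 this also holds when |z| > r, both sides being then false. *)
Lemma le_enorm_height n (r t : R) (z : 'rV[R]_n) : 0 <= r -> 0 < t ->
  (enorm (cons_rV (t, z)) <= r) = (t <= height r z).
Proof.
move=> r0 t0; rewrite -(@ler_pXn2r _ 2) ?nnegrE ?enorm_ge0// enorm_cons/= -lerBrDr.
rewrite /height; have [x0|x0] := leP 0 (r ^+ 2 - enorm z ^+ 2).
  by rewrite -{2}(ger0_norm (ltW t0)) -sqrtr_sqr ler_sqrt.
by rewrite ltr0_sqrtr// !leNgt t0/= (lt_le_trans x0)// sqr_ge0.
Qed.

(** Difference of two square roots; the truncation at 0 of the smaller one only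
    decreases the left-hand side. *)
Lemma height_diff_le n (lo hi : R) (z : 'rV[R]_n) : 0 <= lo -> lo <= hi ->
  height hi z - height lo z <= (hi ^+ 2 - lo ^+ 2) * (height hi z)^-1.
Proof.
move=> lo0 lohi; have LH := ler_height z lo0 lohi.
have [H0|H0] := eqVneq (height hi z) 0.
  by rewrite H0 invr0 mulr0 sub0r oppr_le0 height_ge0.
have Hp : 0 < height hi z by rewrite lt_def H0 height_ge0.
rewrite ler_pdivlMr//.
have H2 : height hi z ^+ 2 = hi ^+ 2 - enorm z ^+ 2.
  by rewrite sqr_sqrtr// ltW// -sqrtr_gt0.
have L2 : lo ^+ 2 - enorm z ^+ 2 <= height lo z ^+ 2.
  have [x0|x0] := leP 0 (lo ^+ 2 - enorm z ^+ 2).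
    by rewrite /height sqr_sqrtr.
  by rewrite (le_trans (ltW x0))// sqr_ge0.
have L0 := height_ge0 lo z.
have : height lo z ^+ 2 <= height lo z * height hi z by rewrite expr2 ler_wpM2l.
rewrite mulrBl -expr2 H2; lra.
Qed.

Lemma measurable_height n r : measurable_fun setT (@height n r).
Proof.
apply: (@measurableT_comp _ _ _ _ _ _ (@Num.sqrt R)).
  exact: measurable_sqrtr.
apply: measurable_funB => //; apply: measurable_funX; exact: measurable_enorm.
Qed.

Lemma measurable_heightV n r : measurable_fun setT (fun z => (@height n r z)^-1).
Proof.
apply: measurable_sqrtrV.
apply: measurable_funB => //; apply: measurable_funX; exact: measurable_enorm.
Qed.

(** In dimension 0 the integral is that of a Dirac mass; otherwise one coordinate
    contributes at most pi and the other ones range over a cube of side 2r. *)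
Definition heightV_bound n (r : R) :=
  if n is m.+1 then pi * (2 * r) ^+ m else r^-1.

Lemma integral_heightV n (r : R) : 0 < r ->
  (\int[lebesgue_rV R n]_z ((height r z)^-1)%:E <= (heightV_bound n r)%:E)%E.
Proof.
move=> r0; case: n => [|n].
  rewrite integral_dirac//; last first.
    by apply/measurable_EFinP; exact: measurable_heightV.
  rewrite diracT mul1e lee_fin.
  by rewrite /height enorm0 expr0n subr0 sqrtr_sqr gtr0_norm.
have mh : measurable_fun setT (fun z : 'rV[R]_n.+1 => ((height r z)^-1)%:E).
  by apply/measurable_EFinP; exact: measurable_heightV.
have h0 (z : 'rV[R]_n.+1) : (0 <= ((height r z)^-1)%:E)%E.
  by rewrite lee_fin invr_ge0 height_ge0.
rewrite (ge0_integral_preserving (preserving_cons_rV R n) mh)//.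
rewrite fubini_tonelli2//=; last first.
  exact: measurableT_comp mh (@measurable_cons_rV R n).
have cubeE : lebesgue_rV R n (cube n (- r) r) = ((2 * r) ^+ n)%:E.
  rewrite lebesgue_cube; last by lra.
  by congr (_ ^+ _)%:E; ring.
rewrite EFinM -[X in (_ <= _ * X)%E](cubeE : _ = _) -integral_cst//; last first.
  exact: measurable_cube.
rewrite [leRHS]integral_mkcond; apply: ge0_le_integral => //.
- by move=> z _; apply: integral_ge0.
- apply: measurable_fun_fubini_tonelli_G => //.
  exact: measurableT_comp mh (@measurable_cons_rV R n).
- by apply/(measurable_restrictT _ _).1 => //; exact: measurable_cube.
- move=> z _; rewrite /fubini_G /patch; under eq_integral do rewrite height_cons.
  case: ifPn => [_|zc]; first exact: integral_inverse_sqrt.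
  rewrite integral0_eq// => t _; rewrite ler0_sqrtr ?invr0//.
  rewrite subr_le0 (le_trans _ (sqr_ge0 t))// subr_le0.
  rewrite ler_pXn2r ?nnegrE ?enorm_ge0 ?(ltW r0)// leNgt.
  by apply: contra zc => zr; apply/mem_set/ball_sub_cube/ltW.
Qed.

Definition shell n (lo hi : R) : set 'rV[R]_n :=
  [set h | lo <= enorm h <= hi].
Arguments shell : clear implicits.

Lemma measurable_shell n (lo hi : R) : measurable (shell n lo hi).
Proof.
rewrite (_ : shell n lo hi = @enorm R n @^-1` `[lo, hi]%classic).
  by rewrite -[X in measurable X]setTI; exact: measurable_enorm.
by apply/seteqP; split => h /=; rewrite in_itv.
Qed.

(** The slice of a shell above z is covered by the two intervals of
    those t with |t| between the heights for [lo] and [hi]. *)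
Lemma lebesgue_shell_slice n (lo hi : R) (z : 'rV[R]_n) : 0 <= lo -> lo <= hi ->
  (\int[lebesgue_measure]_t
    (\1_(shell n.+1 lo hi) (cons_rV (t, z)))%:E <=
   (2 * (hi ^+ 2 - lo ^+ 2) * (height hi z)^-1)%:E)%E.
Proof.
move=> lo0 lohi; pose a := height lo z; pose b := height hi z.
have ab : a <= b by exact: ler_height.
apply: (@le_trans _ _ (\int[lebesgue_measure]_t
    ((\1_[set` `[a, b]%R] t)%:E + (\1_[set` `[(- b)%R, (- a)%R]] t)%:E))%E).
  apply: ge0_le_integral => //.
  - apply/measurable_EFinP; apply: (@measurableT_comp _ _ _ _ _ _
      (\1_(shell n.+1 lo hi) : _ -> R)).
      by apply: measurable_indic; exact: measurable_shell.
    apply: (measurableT_comp (@measurable_cons_rV R n)).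
    exact: measurable_fun_pair.
  - apply: emeasurable_funD; apply/measurable_EFinP;
    exact: measurable_indic.
  - move=> t _; rewrite -EFinD lee_fin indicE.
    have [/set_mem/=/andP[lot thi]|_] := boolP (_ \in _); last first.
      by rewrite addr_ge0// indicE.
    have sq r : 0 <= r -> height r z <= `|t| = (r ^+ 2 - enorm z ^+ 2 <= t ^+ 2).
      by move=> _; rewrite -sqrtr_sqr ler_sqrt ?sqr_ge0.
    have at_ : a <= `|t|.
      rewrite sq// lerBlDr -(@enorm_cons R n (t, z)).
      by rewrite ler_pXn2r// nnegrE enorm_ge0.
    have tb : `|t| <= b.
      rewrite -sqrtr_sqr; apply: ler_wsqrtr; rewrite lerBrDr.
      rewrite -(@enorm_cons R n (t, z)) ler_pXn2r// nnegrE ?enorm_ge0//.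
      exact: le_trans lohi.
    rewrite !indicE !mem_setE !in_itv/=.
    have [t0|t0] := leP 0 t.
      by rewrite ger0_norm// in at_ tb; rewrite at_ tb/= lerDl.
    rewrite ltr0_norm// in at_ tb.
    by rewrite lerNl tb lerNr at_/= lerDr.
rewrite ge0_integralD//; last 2 first.
- exact/measurable_EFinP/measurable_indic.
- exact/measurable_EFinP/measurable_indic.
rewrite !integral_indic// ?setIT [X in (X + _ <= _)%E]lebesgue_measure_itv.
rewrite [X in (_ + X <= _)%E]lebesgue_measure_itv/= !lte_fin ltrN2.
have h := height_diff_le z lo0 lohi.
case: ifP => _; last first.
  rewrite adde0 lee_fin mulr_ge0 ?invr_ge0 ?height_ge0// mulr_ge0// subr_ge0.
  by rewrite ler_pXn2r// nnegrE; exact: le_trans lohi.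
by rewrite -!EFinB -EFinD lee_fin -mulrA /a /b; lra.
Qed.

Lemma lebesgue_shell_le n (lo hi : R) : 0 <= lo -> lo <= hi -> 0 < hi ->
  (lebesgue_rV R n.+1 (shell n.+1 lo hi) <=
   (2 * (hi ^+ 2 - lo ^+ 2) * heightV_bound n hi)%:E)%E.
Proof.
move=> lo0 lohi hi0; set A := shell _ _ _.
have mA : measurable A by exact: measurable_shell.
have m1 : measurable_fun setT (fun h => (\1_A h : R)%:E).
  exact/measurable_EFinP/measurable_indic.
rewrite -(setIT A) -integral_indic//.
rewrite (ge0_integral_preserving (preserving_cons_rV R n) m1)//.
rewrite fubini_tonelli2//=; last first.
  exact: measurableT_comp m1 (@measurable_cons_rV R n).
have c0 : 0 <= 2 * (hi ^+ 2 - lo ^+ 2).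
  rewrite mulr_ge0// subr_ge0 ler_pXn2r// nnegrE; exact: le_trans lohi.
apply: (@le_trans _ _ (\int[lebesgue_rV R n]_z
    ((2 * (hi ^+ 2 - lo ^+ 2))%:E * ((height hi z)^-1)%:E))%E).
  apply: ge0_le_integral => //.
  - by move=> z _; apply: integral_ge0.
  - apply: measurable_fun_fubini_tonelli_G => //.
    exact: measurableT_comp m1 (@measurable_cons_rV R n).
  - by apply: measurable_funeM; apply/measurable_EFinP; exact: measurable_heightV.
  - by move=> z _; exact: lebesgue_shell_slice.
rewrite ge0_integralZl//.
- by rewrite [leRHS]EFinM lee_wpmul2l// integral_heightV.
- by apply/measurable_EFinP; exact: measurable_heightV.
- by move=> z _; rewrite lee_fin invr_ge0 height_ge0.
Qed.

End height.
Arguments shell {R}.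

(** * Thin half-shells *)

Section Rintegral_bounds.
Context d (T : measurableType d) (R : realType).
Variable mu : {measure set T -> \bar R}.

Lemma integrable_bounded_on A (f : T -> R) (M : R) : measurable A ->
  (mu A < +oo)%E -> measurable_fun A f -> (forall x, A x -> `|f x| <= M) ->
  mu.-integrable A (EFin \o f).
Proof.
move=> mA Aoo mf fM; apply: measurable_bounded_integrable => //.
exists M; split; first exact: num_real.
by move=> r Mr x Ax; apply: le_trans (fM x Ax) (ltW Mr).
Qed.

Lemma le_normr_Rintegral_cst A (f : T -> R) (M : R) : measurable A ->
  (mu A < +oo)%E -> measurable_fun A f -> (forall x, A x -> `|f x| <= M) ->
  `|\int[mu]_(x in A) f x| <= M * fine (mu A).
Proof.
move=> mA Aoo mf fM; have iF := integrable_bounded_on mA Aoo mf fM.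
apply: (le_trans (le_normr_Rintegral mA iF)); rewrite -Rintegral_cst//.
apply: le_Rintegral => //.
  exact: integrable_norm iF.
apply: (@integrable_bounded_on A (fun=> M) `|M|) => //.
Qed.

Lemma Rdominated_cvg D (f_ : nat -> T -> R) (f g : T -> R) : measurable D ->
  (forall n, measurable_fun D (f_ n)) ->
  (forall x, D x -> f_ n x @[n --> \oo] --> f x) ->
  mu.-integrable D (EFin \o g) ->
  (forall n x, D x -> `|f_ n x| <= g x) ->
  \int[mu]_(x in D) f_ n x @[n --> \oo] --> \int[mu]_(x in D) f x.
Proof.
move=> mD mf cf ig fg.
have mf' n : measurable_fun D (EFin \o f_ n) by exact/measurable_EFinP.
have cf' x : D x -> (f_ n x)%:E @[n --> \oo] --> (f x)%:E.
  by move=> Dx; apply: cvg_EFin; [exact: nearW|exact: cf].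
have fg' n x : D x -> (`|(f_ n x)%:E| <= (g x)%:E)%E.
  by move=> Dx; rewrite lee_fin fg.
have mlim : measurable_fun D (EFin \o f).
  exact/measurable_EFinP/(measurable_fun_cvg mf cf).
have [iF _ cv] := dominated_convergence mD mf' mlim (aeW _ cf') ig
  (aeW _ (fun x n => fg' n x)).
apply: fine_cvg; rewrite /Rintegral fineK//.
exact: integrable_fin_num.
Qed.

End Rintegral_bounds.

Section interval_mean.
Context (R : realType).
Notation mu := (@lebesgue_measure R).

Lemma fine_lebesgue_itvoc (a b : R) : a <= b ->
  fine (mu [set` `]a, b]]) = b - a.
Proof.
move=> ab; rewrite lebesgue_measure_itv/= lte_fin.
by case: ltgtP ab => //= -> _; rewrite subrr.
Qed.

Lemma lebesgue_itvoc_lty (a b : R) : (mu [set` `]a, b]] < +oo)%E.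
Proof.
rewrite lebesgue_measure_itv/= lte_fin; case: ifP => _; last exact: ltry.
by rewrite -EFinB ltry.
Qed.

(** Means of a function over intervals shrinking to a point of continuity, the
    lengths being measured in units of [w]. *)
Lemma interval_mean_cvg (g : R -> R) (p L : R) (a b w : R^nat) :
  measurable_fun setT g -> g t @[t --> p] --> g p ->
  a @ \oo --> p -> b @ \oo --> p -> (forall k, a k <= b k) ->
  (forall k, 0 < w k) -> (b k - a k) / w k @[k --> \oo] --> L ->
  (forall k, mu.-integrable [set` `]a k, b k]] (EFin \o g)) ->
  (\int[mu]_(t in `]a k, b k]) g t) / w k @[k --> \oo] --> g p * L.
Proof.
move=> mg cg ap bp ab w0 wL ig.
pose q k := (b k - a k) / w k.
have q0 k : 0 <= q k by rewrite divr_ge0 ?subr_ge0// ltW.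
(* the error made in replacing g by g p *)
pose e k := (\int[mu]_(t in `]a k, b k]) g t) / w k - g p * q k.
suff e0 : e @ \oo --> 0.
  have -> : (fun k => (\int[mu]_(t in `]a k, b k]) g t) / w k) =
      e \+ (fun k => g p * q k).
    by apply/funext => k; rewrite /e /= subrK.
  by rewrite -[X in _ --> X]add0r; apply: cvgD => //; apply: cvgMr.
apply/cvgr0Pnorm_le => eps eps0.
have L0 : 0 <= L.
  by apply: (cvgr_to_ge wL); exact: nearW.
pose eta := eps / (L + 1).
have eta0 : 0 < eta by rewrite divr_gt0// ltr_wpDl.
have /cvgrPdist_le/(_ _ eta0)[r /= r0 gr] := cg.
near=> k.
have Ge t : `]a k, b k]%classic t -> `|g t - g p| <= eta.
  rewrite /= in_itv/= => /andP[at_ tb]; rewrite distrC; apply: gr => /=.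
  have : `|p - a k| < r by near: k; exact: cvgr_dist_lt.
  have : `|p - b k| < r by near: k; exact: cvgr_dist_lt.
  rewrite !ltr_norml; lra.
have Ek : e k = (\int[mu]_(t in `]a k, b k]) (g t - g p)) / w k.
  rewrite RintegralB//; last first.
    apply: (@integrable_bounded_on _ _ _ _ _ (fun=> g p) `|g p|) => //.
    exact: lebesgue_itvoc_lty.
  rewrite Rintegral_cst// fine_lebesgue_itvoc// /e /q.
  by rewrite [RHS]mulrBl mulrA.
rewrite Ek normrM normfV (gtr0_norm (w0 k)) ler_pdivrMr//.
apply: (@le_trans _ _ (eta * fine (mu `]a k, b k]%classic))).
  apply: le_normr_Rintegral_cst => //; first exact: lebesgue_itvoc_lty.
  by apply: measurable_funTS; exact: measurable_funB.
rewrite fine_lebesgue_itvoc// -ler_pdivrMr// -mulrA -/(q k).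
have -> : eps = eta * (L + 1) by rewrite /eta divfK// gt_eqF// ltr_wpDl.
rewrite ler_pM2l//; apply/ltW; near: k; apply: (cvgr_lt L) => //.
by rewrite ltrDl.
Unshelve. all: by end_near. Qed.

End interval_mean.

(** The constant must not depend on [hi]; in dimension 0 the shell is empty. *)
Lemma lebesgue_shell_bound (R : realType) n (d : R) : 0 < d ->
  exists2 K : R, 0 <= K & forall hi, d <= hi <= 2 * d ->
    (lebesgue_rV R n (shell n d hi) <= (K * (hi ^+ 2 - d ^+ 2))%:E)%E.
Proof.
move=> d0; case: n => [|n].
  exists 0 => // hi _; rewrite mul0r (_ : shell 0 d hi = set0) ?measure0//.
  apply/seteqP; split => // z; rewrite /shell /= (_ : z = 0) ?enorm0; last first.
    by apply/rowP => -[].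
  by rewrite leNgt d0.
pose K := d^-1 + pi * (4 * d) ^+ n.-1.
have K0 : 0 <= K.
  by rewrite addr_ge0 ?invr_ge0 ?mulr_ge0 ?pi_ge0 ?exprn_ge0 ?mulr_ge0 ?ltW.
exists (2 * K); first by rewrite mulr_ge0.
move=> hi /andP[dhi hid]; have hi0 := lt_le_trans d0 dhi.
apply: (le_trans (lebesgue_shell_le n (ltW d0) dhi hi0)).
rewrite lee_fin mulrAC ler_wpM2r ?subr_ge0 ?ler_pXn2r ?nnegrE ?(ltW d0) ?(ltW hi0)//.
rewrite ler_pM2l// /K; case: n {K K0} => [|n] /=.
  rewrite expr0 mulr1 (@le_trans _ _ d^-1) ?lef_pV2 ?posrE//.
  by rewrite lerDl pi_ge0.
rewrite (@le_trans _ _ (pi * (4 * d) ^+ n))//.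
  rewrite ler_wpM2l ?pi_ge0// lerXn2r ?nnegrE; lra.
by rewrite lerDr invr_ge0 ltW.
Qed.

Section half_shell.
Context (R : realType) (n : nat).
Local Notation leb := (lebesgue_rV R n).
Variables (f : R * 'rV[R]_n -> R) (d M : R).
Hypotheses (mf : measurable_fun setT f) (d0 : 0 < d).
Hypothesis fM : forall t z, d / 2 < enorm (cons_rV (t, z)) -> `|f (t, z)| <= M.

(** The part t > 0 of the slice above z of the shell lo < |(t, z)| <= hi is exactly
    this interval. *)
Definition half_slice (lo hi : R) (z : 'rV[R]_n) :=
  \int[lebesgue_measure]_(t in `]height lo z, height hi z]) f (t, z).

Lemma half_slice_dom lo hi t z : d / 2 < lo -> lo <= hi ->
  `]height lo z, height hi z]%classic t -> `|f (t, z)| <= M.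
Proof.
move=> dlo lohi /=; rewrite in_itv/= => /andP[lot thi]; apply: fM.
have lo0 : 0 <= lo by apply: le_trans (ltW dlo); rewrite divr_ge0// ltW.
have t0 : 0 < t by exact: le_lt_trans (height_ge0 _ _) lot.
by apply: (lt_trans dlo); rewrite ltNge le_enorm_height// -ltNge.
Qed.

Lemma measurable_section z : measurable_fun setT (fun t => f (t, z)).
Proof. exact: measurableT_comp mf (measurable_pair2 z). Qed.

Lemma integrable_half_slice lo hi z : d / 2 < lo -> lo <= hi ->
  lebesgue_measure.-integrable [set` `]height lo z, height hi z]]
    (EFin \o (fun t => f (t, z))).
Proof.
move=> dlo lohi; apply: (@integrable_bounded_on _ _ _ _ _ _ M) => //.
- exact: lebesgue_itvoc_lty.
- by apply: measurable_funTS; exact: measurable_section.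
- by move=> t; exact: half_slice_dom.
Qed.

Lemma half_slice_le lo hi z : d / 2 < lo -> lo <= hi ->
  `|half_slice lo hi z| <= M * (height hi z - height lo z).
Proof.
move=> dlo lohi.
have lo0 : 0 <= lo by apply: le_trans (ltW dlo); rewrite divr_ge0// ltW.
rewrite -fine_lebesgue_itvoc ?ler_height//.
apply: le_normr_Rintegral_cst => //.
- exact: lebesgue_itvoc_lty.
- by apply: measurable_funTS; exact: measurable_section.
- by move=> t; exact: half_slice_dom.
Qed.

Lemma measurable_half_slice lo hi : measurable_fun setT (half_slice lo hi).
Proof.
pose F (p : R * 'rV[R]_n) :=
  if (height lo p.2 < p.1) && (p.1 <= height hi p.2) then f p else 0.
have mh r : measurable_fun setT (fun p : R * 'rV[R]_n => height r p.2).
  exact: measurableT_comp (@measurable_height R n r) measurable_snd.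
have mF : measurable_fun setT F.
  apply: measurable_fun_ifT; [|exact: mf|exact: measurable_cst].
  apply: measurable_and.
    by apply: measurable_fun_ltr; [exact: mh|exact: measurable_fst].
  by apply: measurable_fun_ler; [exact: measurable_fst|exact: mh].
rewrite (_ : half_slice lo hi = fun z => \int[lebesgue_measure]_t F (t, z)).
  exact (@measurable_Rintegral_l _ _ (measurableTypeR R) _ R lebesgue_measure F mF).
apply/funext => z; rewrite /half_slice Rintegral_mkcond.
by apply: eq_Rintegral => t _; rewrite /patch mem_setE in_itv.
Qed.

Lemma half_slice_heightV lo hi z : 0 <= M -> d / 2 < lo -> lo <= hi ->
  `|half_slice lo hi z| <= M * (hi ^+ 2 - lo ^+ 2) * (height hi z)^-1.
Proof.
move=> M0 dlo lohi; apply: (le_trans (half_slice_le z dlo lohi)).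
rewrite -mulrA ler_wpM2l//; apply: height_diff_le => //.
by apply: le_trans (ltW dlo); rewrite divr_ge0// ltW.
Qed.

Lemma integrable_heightV c r : 0 < r ->
  leb.-integrable setT (EFin \o (fun z => c * (height r z)^-1)).
Proof.
move=> r0; rewrite /comp; under eq_fun do rewrite EFinM.
apply: integrableZl => //; apply/integrableP; split.
  by apply/measurable_EFinP; exact: measurable_heightV.
under eq_integral do rewrite gee0_abs ?lee_fin ?invr_ge0 ?height_ge0//.
exact: le_lt_trans (integral_heightV n r0) (ltry _).
Qed.

Lemma integrable_int_half_slice lo hi : 0 <= M -> d / 2 < lo -> lo <= hi ->
  leb.-integrable setT (EFin \o half_slice lo hi).
Proof.
move=> M0 dlo lohi.
have hi0 : 0 < hi.
  by apply: lt_le_trans lohi; apply: lt_trans dlo; rewrite divr_gt0.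
apply: (le_integrable measurableT _ _
  (integrable_heightV (M * (hi ^+ 2 - lo ^+ 2)) hi0)).
  by apply/measurable_EFinP; exact: measurable_half_slice.
move=> z _ /=; rewrite lee_fin.
by apply: (le_trans (half_slice_heightV z M0 dlo lohi)); exact: ler_norm.
Qed.

Variables (lo hi : R^nat).
Hypothesis fc : forall z, enorm z < d ->
  f (t, z) @[t --> height d z] --> f (height d z, z).
Hypotheses (dlo : forall k, d / 2 < lo k) (lod : forall k, lo k <= d)
  (dhi : forall k, d <= hi k) (hid : forall k, hi k <= 2 * d)
  (lohi : forall k, lo k < hi k).
Hypotheses (lo_cvg : lo @ \oo --> d) (hi_cvg : hi @ \oo --> d).

Lemma height_cvg (r : R^nat) (z : 'rV[R]_n) : r @ \oo --> d ->
  height (r k) z @[k --> \oo] --> height d z.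
Proof.
move=> rd; apply: continuous_cvg; first exact (@sqrt_continuous R _).
by apply: cvgB; [rewrite expr2; under eq_fun do rewrite expr2; exact: cvgM
                |exact: cvg_cst].
Qed.

(** The length of the slice divided by hi - lo is
    (hi + lo) / (height hi z + height lo z), as both heights are eventually
    positive. *)
Lemma half_slice_cvg z : enorm z < d ->
  half_slice (lo k) (hi k) z / (hi k - lo k) @[k --> \oo] -->
  f (height d z, z) * (d / height d z).
Proof.
move=> zd; have h0 := height_gt0 zd.
apply: (@interval_mean_cvg _ (fun t => f (t, z))).
- exact: measurable_section.
- exact: fc.
- exact: height_cvg.
- exact: height_cvg.
- move=> k; apply: ler_height; last exact: ltW.
  by apply: le_trans (ltW (dlo k)); rewrite divr_ge0// ltW.
- by move=> k; rewrite subr_gt0.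
- have -> : d / height d z = (d + d) * (height d z + height d z)^-1.
    by field; rewrite !gt_eqF ?addr_gt0.
  apply: (@cvg_trans _ ((hi k + lo k) *
      (height (hi k) z + height (lo k) z)^-1 @[k --> \oo])); last first.
    apply: cvgM; first exact: cvgD.
    apply: cvgV; first by rewrite gt_eqF// addr_gt0.
    by apply: cvgD; exact: height_cvg.
  apply: near_eq_cvg; near=> k.
  have zlo : enorm z < lo k by near: k; exact: (cvgr_gt d).
  have L0 := height_gt0 zlo.
  have H0 := height_gt0 (lt_trans zlo (lohi k)).
  have L2 : height (lo k) z ^+ 2 = lo k ^+ 2 - enorm z ^+ 2.
    by rewrite sqr_sqrtr// ltW// -sqrtr_gt0.
  have H2 : height (hi k) z ^+ 2 = hi k ^+ 2 - enorm z ^+ 2.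
    by rewrite sqr_sqrtr// ltW// -sqrtr_gt0.
  have w0 : 0 < hi k - lo k by rewrite subr_gt0.
  apply/eqP; rewrite eqr_div ?(gt_eqF w0) ?(gt_eqF (addr_gt0 H0 L0))//; apply/eqP.
  transitivity (hi k ^+ 2 - lo k ^+ 2); first by ring.
  transitivity (height (hi k) z ^+ 2 - height (lo k) z ^+ 2); last by ring.
  by rewrite H2 L2; ring.
- by move=> k; apply: integrable_half_slice => //; exact: ltW.
Unshelve. all: by end_near. Qed.

Let inner := [set z : 'rV[R]_n | enorm z < d].

Lemma measurable_ball_rV : measurable inner.
Proof.
rewrite (_ : inner = @enorm R n @^-1` `]-oo, d[%classic).
  by rewrite -[X in measurable X]setTI; exact: measurable_enorm.
by apply/seteqP; split => z; rewrite /inner /= in_itv.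
Qed.

Hypothesis M0 : 0 <= M.

Let w0 k : 0 < hi k - lo k. Proof. by rewrite subr_gt0. Qed.

(** Dominated convergence: the slices have length at most
    (hi^2 - lo^2) / height hi z, and height hi >= height d. *)
Lemma half_shell_inner_cvg :
  \int[leb]_(z in inner) (half_slice (lo k) (hi k) z / (hi k - lo k))
    @[k --> \oo] -->
  \int[leb]_(z in inner) (f (height d z, z) * (d / height d z)).
Proof.
apply: (@Rdominated_cvg _ _ _ _ _ _ _ (fun z => (M * (3 * d)) * (height d z)^-1)).
- exact: measurable_ball_rV.
- move=> k; apply: measurable_funTS; apply: measurable_funM => //.
  exact: measurable_half_slice.
- by move=> z; exact: half_slice_cvg.
- by apply: integrableS (integrable_heightV _ d0) => //; exact: measurable_ball_rV.
- move=> k z /= zd; rewrite normrM normfV (gtr0_norm (w0 k)) ler_pdivrMr//.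
  apply: (le_trans (half_slice_heightV z M0 (dlo k) (ltW (lohi k)))).
  rewrite -!mulrA ler_wpM2l//.
  have hd := height_gt0 zd.
  have hh : height d z <= height (hi k) z by rewrite ler_height// ltW.
  have -> : 3 * (d * ((height d z)^-1 * (hi k - lo k))) =
    (3 * d * (hi k - lo k)) * (height d z)^-1 by ring.
  apply: ler_pM.
  + rewrite subr_ge0 ler_pXn2r ?nnegrE ?(ltW (lohi k))//.
      by apply: le_trans (ltW (dlo k)); rewrite divr_ge0// ltW.
    by apply: le_trans (dhi k); rewrite ltW.
  + by rewrite invr_ge0 height_ge0.
  + rewrite subr_sqr mulrC ler_pM2r//; have := hid k; have := lod k; lra.
  + by rewrite lef_pV2// posrE// (lt_le_trans hd).
Qed.

(** Only |z| <= hi matters.  There the slices have length at most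
    sqrt (hi^2 - d^2), and the set d <= |z| <= hi has volume O(hi^2 - d^2), so
    that the quotient by hi - lo >= hi - d is O(sqrt (hi^2 - d^2)). *)
Lemma half_shell_outer_cvg :
  (\int[leb]_(z in ~` inner) half_slice (lo k) (hi k) z) / (hi k - lo k)
    @[k --> \oo] --> 0.
Proof.
have [K K0 KP] := lebesgue_shell_bound n d0.
have bound k : `|(\int[leb]_(z in ~` inner) half_slice (lo k) (hi k) z) /
    (hi k - lo k)| <= M * K * (3 * d) * Num.sqrt (hi k ^+ 2 - d ^+ 2).
  have hd2 : 0 <= hi k ^+ 2 - d ^+ 2.
    rewrite subr_ge0 ler_pXn2r ?nnegrE ?(ltW d0)//.
    by apply: le_trans (dhi k); rewrite ltW.
  have mS := @measurable_shell R n d (hi k).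
  have mI := measurable_ball_rV.
  have Soo : (leb (shell n d (hi k)) < +oo)%E.
    by apply: le_lt_trans (KP _ _) (ltry _); rewrite dhi hid.
  have out z : ~ shell n d (hi k) z -> ~ inner z ->
      half_slice (lo k) (hi k) z = 0.
    rewrite /shell /inner /= => /negP + /negP; rewrite -leNgt => + zd.
    rewrite zd/= -ltNge => zhi; apply/eqP; rewrite -normr_le0.
    apply: (le_trans (half_slice_heightV z M0 (dlo k) (ltW (lohi k)))).
    rewrite (height_eq0 _ (ltW zhi)) ?invr0 ?mulr0//.
    by apply: le_trans (dhi k); rewrite ltW.
  have sub z : shell n d (hi k) z -> ~ inner z.
    by rewrite /shell /inner /= => /andP[+ _]; rewrite leNgt => /negP.
  rewrite (_ : Rintegral _ _ _ =
      \int[leb]_(z in shell n d (hi k)) half_slice (lo k) (hi k) z); last first.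
    rewrite Rintegral_mkcond [RHS]Rintegral_mkcond; apply: eq_Rintegral => z _.
    rewrite /patch; case: ifPn => [/set_mem zI|/negP zI]; case: ifPn => //.
      by move=> /negP zS; apply: out => // /mem_set.
    by move=> /set_mem zS; exfalso; apply: zI; apply/mem_set; exact: sub.
  rewrite normrM normfV (gtr0_norm (w0 k)) ler_pdivrMr//.
  apply: (@le_trans _ _ (M * Num.sqrt (hi k ^+ 2 - d ^+ 2) *
      fine (leb (shell n d (hi k))))).
    apply: le_normr_Rintegral_cst => //.
      by apply: measurable_funTS; exact: measurable_half_slice.
    move=> z /andP[dz _]; apply: (le_trans (half_slice_le z (dlo k) (ltW (lohi k)))).
    rewrite ler_wpM2l// lerBlDr (le_trans (y := Num.sqrt (hi k ^+ 2 - d ^+ 2)))//.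
      apply: ler_wsqrtr; rewrite lerD2l lerN2 ler_pXn2r ?nnegrE ?enorm_ge0//.
      exact: ltW.
    by rewrite lerDl height_ge0.
  have Sle : fine (leb (shell n d (hi k))) <= K * (3 * d * (hi k - lo k)).
    apply: (@le_trans _ _ (K * (hi k ^+ 2 - d ^+ 2))).
      by rewrite -lee_fin fineK ?ge0_fin_numE// KP// dhi hid.
    rewrite ler_wpM2l// subr_sqr mulrC; apply: ler_pM.
    - by rewrite addr_ge0 ?(ltW d0)// (le_trans (ltW d0)).
    - by rewrite subr_ge0.
    - by have := hid k; lra.
    - by rewrite lerD2l lerN2.
  apply: (le_trans (ler_wpM2l _ Sle)); first by rewrite mulr_ge0 ?sqrtr_ge0.
  by rewrite le_eqVlt; apply/orP; left; apply/eqP; ring.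
apply/cvgr0Pnorm_le => e e0; near=> k; apply: (le_trans (bound k)).
near: k; apply: (cvgr_le 0) => //.
rewrite -[X in _ --> X](mulr0 (M * K * (3 * d))); apply: cvgMr.
rewrite -sqrtr0 -(subrr (d ^+ 2)).
apply: continuous_cvg; first exact (@sqrt_continuous R _).
by apply: cvgB; [rewrite expr2; under eq_fun do rewrite expr2; exact: cvgM
                |exact: cvg_cst].
Unshelve. all: by end_near. Qed.

Lemma half_shell_cvg :
  (\int[leb]_z half_slice (lo k) (hi k) z) / (hi k - lo k) @[k --> \oo] -->
  \int[leb]_(z in inner) (f (height d z, z) * (d / height d z)).
Proof.
have mI := measurable_ball_rV.
have iI k : leb.-integrable setT (EFin \o half_slice (lo k) (hi k)).
  by apply: integrable_int_half_slice => //; exact: ltW.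
have E k : (\int[leb]_z half_slice (lo k) (hi k) z) / (hi k - lo k) =
    \int[leb]_(z in inner) (half_slice (lo k) (hi k) z / (hi k - lo k)) +
    (\int[leb]_(z in ~` inner) half_slice (lo k) (hi k) z) / (hi k - lo k).
  rewrite RintegralZr//; last exact: integrableS (iI k).
  rewrite -mulrDl -Rintegral_setU ?setUCr//; first exact: measurableC.
  by apply/disj_setPS; rewrite setICr.
rewrite (funext E).
have := cvgD half_shell_inner_cvg half_shell_outer_cvg; rewrite addr0; exact.
Qed.

End half_shell.

(** * Differentiating integrals over shells *)

Section Rfubini.
Context d1 d2 (T1 : measurableType d1) (T2 : measurableType d2) (R : realType).
Variables (m1 : {sigma_finite_measure set T1 -> \bar R})
  (m2 : {sigma_finite_measure set T2 -> \bar R}) (f : T1 * T2 -> R).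
Hypothesis If : (m1 \x m2)%E.-integrable setT (EFin \o f).

Lemma Rfubini1 :
  \int[(m1 \x m2)%E]_p f p = \int[m1]_x \int[m2]_y f (x, y).
Proof.
rewrite /Rintegral -(integral12_prod_meas1 If); congr fine.
apply: ae_eq_integral => //.
- exact: (measurable_int m1 (integrable_fubini_F If)).
- apply/measurable_EFinP; apply: (@measurableT_comp _ _ _ _ _ _ (@fine R)).
    exact: fine_measurable.
  exact: (measurable_int m1 (integrable_fubini_F If)).
- apply: filterS (ae_integrable1 If) => x Ix _.
  by rewrite fineK//; exact: integrable_fin_num.
Qed.

Lemma Rfubini2 :
  \int[(m1 \x m2)%E]_p f p = \int[m2]_y \int[m1]_x f (x, y).
Proof.
rewrite /Rintegral -(integral21_prod_meas1 If); congr fine.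
apply: ae_eq_integral => //.
- exact: measurable_fubini_G If.
- apply/measurable_EFinP; apply: (@measurableT_comp _ _ _ _ _ _ (@fine R)).
    exact: fine_measurable.
  exact: measurable_fubini_G If.
- apply: filterS (ae_integrable2 If) => y Iy _.
  by rewrite fineK//; exact: integrable_fin_num.
Qed.

End Rfubini.

Lemma preserving_oppr (R : realType) :
  preserving (@lebesgue_measure R) (@lebesgue_measure R) (fun x : R => - x).
Proof.
split; first exact: measurable_funN.
by move=> A mA; exact/esym/lebesgue_measureN.
Qed.

Lemma Rintegral_fold (R : realType) (h : R -> R) :
  (@lebesgue_measure R).-integrable setT (EFin \o h) ->
  \int[lebesgue_measure]_t h t =
  \int[lebesgue_measure]_(t in `]0, +oo[) h t +
  \int[lebesgue_measure]_(t in `]0, +oo[) h (- t).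
Proof.
move=> ih; have mh : measurable_fun setT h.
  by apply/measurable_EFinP; exact: (measurable_int lebesgue_measure).
have -> : [set: R] = `[0, +oo[%classic `|` `]-oo, 0[%classic.
  by apply/seteqP; split => // t _ /=; rewrite !in_itv/= andbT; case: leP; auto.
rewrite Rintegral_setU//.
- congr (_ + _).
    by rewrite Rintegral_itv_obnd_cbnd//; apply: integrableS ih.
  rewrite Rintegral_mkcond (Rintegral_preserving (preserving_oppr R)); last first.
    by apply/(measurable_restrictT _ _).1 => //; exact: measurable_funTS.
  rewrite [RHS]Rintegral_mkcond; apply: eq_Rintegral => t _.
  by rewrite /patch !mem_setE !in_itv/= andbT oppr_lt0.
- by apply: integrableS ih => //; exact: measurableU.
- by apply/disj_setPS => t /=; rewrite !in_itv/= andbT => -[]; case: leP.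
Qed.

Section sphere_derivative.
Context (R : realType) (n : nat).
Variables (F : 'rV[R]_n.+1 -> R) (d M : R).
Hypotheses (mF : measurable_fun setT F) (d0 : 0 < d) (M0 : 0 <= M).
Hypothesis FM : forall h, d / 2 < enorm h -> `|F h| <= M.

(** Half-open, so that shells and balls |h| <= lo add up without overlap. *)
Definition oshell (lo hi : R) : set 'rV[R]_n.+1 :=
  [set h | lo < enorm h <= hi].

Lemma measurable_oshell lo hi : measurable (oshell lo hi).
Proof.
rewrite (_ : oshell lo hi = @enorm R n.+1 @^-1` `]lo, hi]%classic).
  by rewrite -[X in measurable X]setTI; exact: measurable_enorm.
by apply/seteqP; split => h; rewrite /oshell /= in_itv.
Qed.

Let half (b : bool) (p : R * 'rV[R]_n) := F (cons_rV ((-1) ^+ b * p.1, p.2)).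

Let mhalf b : measurable_fun setT (half b).
Proof.
apply: (measurableT_comp mF); apply: (measurableT_comp (@measurable_cons_rV R n)).
apply/measurable_fun_pairP; split; last exact: measurable_snd.
apply: measurable_funM; first exact: measurable_cst.
exact: measurable_fst.
Qed.

Lemma enorm_cons_sign (b : bool) t (z : 'rV[R]_n) :
  enorm (cons_rV ((-1) ^+ b * t, z)) = enorm (cons_rV (t, z)).
Proof.
apply/eqP; rewrite -(@eqrXn2 _ 2) ?enorm_ge0// !enorm_cons/= exprMn.
by rewrite sqrr_sign mul1r.
Qed.

Lemma oshell_lty lo hi : 0 <= lo -> lo < hi ->
  (lebesgue_rV R n.+1 (oshell lo hi) < +oo)%E.
Proof.
move=> lo0 lohi; have hi0 := le_lt_trans lo0 lohi.
apply: le_lt_trans (le_lt_trans (lebesgue_shell_le n lo0 (ltW lohi) hi0) (ltry _)).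
apply: le_measure; rewrite ?inE; [exact: measurable_oshell|exact: measurable_shell|].
by move=> h /andP[/ltW ? ?]; apply/andP.
Qed.

Lemma half_slice_oshell (lo hi : R) (b : bool) (z : 'rV[R]_n) : 0 <= lo -> 0 <= hi ->
  \int[lebesgue_measure]_(t in `]0, +oo[)
    (F \_ (oshell lo hi)) (cons_rV ((-1) ^+ b * t, z)) =
  half_slice (half b) lo hi z.
Proof.
move=> lo0 hi0; rewrite /half_slice Rintegral_mkcond [RHS]Rintegral_mkcond.
apply: eq_Rintegral => t _; rewrite /patch.
have -> : (cons_rV ((-1) ^+ b * t, z) \in oshell lo hi) =
    (lo < enorm (cons_rV (t, z)) <= hi).
  by apply/idP/idP; rewrite inE /oshell /= enorm_cons_sign.
rewrite !mem_setE !in_itv/= andbT.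
have [t0|t0] := ltP 0 t; last first.
  by rewrite ltNge (le_trans t0)// height_ge0.
rewrite ltNge le_enorm_height// -ltNge.
by rewrite le_enorm_height.
Qed.

(** Integrate first along the vertical lines, and fold each of them at t = 0. *)
Lemma int_oshell lo hi : d / 2 < lo -> lo < hi ->
  \int[lebesgue_rV R n.+1]_(h in oshell lo hi) F h =
  \sum_(b : bool) \int[lebesgue_rV R n]_z half_slice (half b) lo hi z.
Proof.
move=> dlo lohi; have lo0 : 0 <= lo.
  by apply: le_trans (ltW dlo); rewrite divr_ge0// ltW.
have mS := measurable_oshell lo hi.
have FS h : `|(F \_ (oshell lo hi)) h| <= M.
  rewrite /patch; case: ifPn => [/set_mem/andP[lh _]|_]; last by rewrite normr0.
  by apply: FM; exact: lt_trans lh.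
have mFS : measurable_fun setT (F \_ (oshell lo hi)).
  by apply/(measurable_restrictT _ _).1 => //; exact: measurable_funTS.
have iF : (lebesgue_rV R n.+1).-integrable setT (EFin \o (F \_ (oshell lo hi))).
  rewrite -restrict_EFin; apply/(integrable_mkcond _ mS).1.
  apply: (@integrable_bounded_on _ _ _ _ _ _ M) => //.
  - exact: oshell_lty.
  - exact: measurable_funTS.
  - by move=> h /andP[lh _]; apply: FM; exact: lt_trans lh.
have mFSE : measurable_fun setT (EFin \o (F \_ (oshell lo hi))).
  exact/measurable_EFinP.
have iFc := (integrable_preserving (preserving_cons_rV R n) mFSE).1 iF.
rewrite Rintegral_mkcond (Rintegral_preserving (preserving_cons_rV R n) mFS).
rewrite (Rfubini2 iFc) big_bool/=.
have iH (b : bool) :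
    (lebesgue_rV R n).-integrable setT (EFin \o half_slice (half b) lo hi).
  apply: (integrable_int_half_slice (d := d) (M := M)) => //; last exact: ltW.
  by move=> t z dz; apply: FM; rewrite enorm_cons_sign.
rewrite addrC -RintegralD//; apply: eq_Rintegral => z _.
have hi0 : 0 <= hi by exact: le_trans (ltW lohi).
rewrite Rintegral_fold; last first.
  have mFz : measurable_fun setT
      (fun t : R => (F \_ (oshell lo hi)) (cons_rV (t, z))).
    apply: (measurableT_comp mFS).
    exact: measurableT_comp (@measurable_cons_rV R n) (measurable_pair2 z).
  rewrite (_ : _ \o _ = EFin \o
      ((fun t : R => (F \_ (oshell lo hi)) (cons_rV (t, z))) \_ `[- hi, hi])).
    rewrite -restrict_EFin; apply/(integrable_mkcond _ _).1 => //.
    apply: (@integrable_bounded_on _ _ _ _ _ _ M) => //.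
    - rewrite [X in (X < _)%E]lebesgue_measure_itv/=.
      by case: ifP => _; [rewrite -EFinB ltry|exact: ltry].
    - exact: measurable_funTS.
  apply/funext => t; rewrite /= [in RHS]/patch; case: ifPn => // th.
  congr EFin; apply: patchN; apply: contra th => /set_mem/andP[_ hhi].
  rewrite mem_setE in_itv/= -ler_norml -(@ler_pXn2r _ 2) ?nnegrE//.
  rewrite real_normK ?num_real//.
  apply: (@le_trans _ _ (enorm (cons_rV (t, z)) ^+ 2)).
    by rewrite enorm_cons lerDl sqr_ge0.
  by rewrite ler_pXn2r ?nnegrE ?enorm_ge0.
rewrite -!(half_slice_oshell _ _ lo0 hi0); congr (_ + _); apply: eq_Rintegral => t _.
  by rewrite expr0 mul1r.
by rewrite expr1 mulN1r.
Qed.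

Hypothesis Fc : forall (b : bool) z, enorm z < d ->
  F (cons_rV ((-1) ^+ b * t, z)) @[t --> height d z] -->
  F (cons_rV ((-1) ^+ b * height d z, z)).

(** The surface integral of F over the sphere of radius d, in graph coordinates;
    [d / height d z] is the surface element. *)
Definition sphere_flux := \sum_(b : bool)
  \int[lebesgue_rV R n]_(z in [set z | enorm z < d])
    (F (cons_rV ((-1) ^+ b * height d z, z)) * (d / height d z)).

(** Along any sequence of increments tending to 0, of whatever signs, the
    difference quotient is the mean of F over the shell between the two radii. *)
Lemma sphere_is_derive (A : R -> R) :
  (forall lo hi, d / 2 < lo -> lo < hi ->
    A hi - A lo = \int[lebesgue_rV R n.+1]_(h in oshell lo hi) F h) ->
  is_derive d 1 A sphere_flux.
Proof.
move=> AE.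
have lim : h^-1 *: (A (h *: (1 : R) + d) - A d) @[h --> 0^'] --> sphere_flux.
  apply/cvgr_dnbhsP => u [u0 uc].
  (* a modification of finitely many terms keeps the radii in ]d / 2, 2 d] *)
  pose u' k := if `|u k| < d / 2 then u k else d / 4.
  have uu' : \forall k \near \oo, u k = u' k.
    near=> k; rewrite /u'; case: ifPn => // /negP[].
    by near: k; apply: cvgr0_norm_lt => //; rewrite divr_gt0.
  have u'0 k : u' k != 0.
    by rewrite /u'; case: ifPn => // _; rewrite gt_eqF// divr_gt0.
  have u'd k : `|u' k| < d / 2.
    rewrite /u'; case: ifPn => // _; have d4 : 0 < d / 4 by rewrite divr_gt0.
    by rewrite gtr0_norm// ltr_pM2l// ltf_pV2 ?posrE// ltr_nat.
  have u'c : u' @ \oo --> 0 by apply: cvg_trans uc; apply: near_eq_cvg.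
  pose lo k := Num.min d (u' k + d); pose hi k := Num.max d (u' k + d).
  have dn k : d != u' k + d.
    by rewrite -[X in X != _]add0r (inj_eq (addIr d)) eq_sym.
  have lohi k : lo k < hi k.
    by rewrite /lo /hi; have := dn k; case: (ltgtP d (u' k + d)).
  have u'cd : (fun k => u' k + d) @ \oo --> d.
    by rewrite -[X in _ --> X]add0r; apply: cvgD => //; exact: cvg_cst.
  have near_d k : `|d - lo k| <= `|u' k| /\ `|d - hi k| <= `|u' k|.
    by rewrite /lo /hi; case: (ltP d (u' k + d)) => _;
      rewrite subrr normr0 opprD addrCA subrr addr0 normrN.
  have loc : lo @ \oo --> d.
    apply/cvgrPdist_le => e e0; near=> k; apply: (le_trans (near_d k).1).
    by near: k; apply: cvgr0_norm_le.
  have hic : hi @ \oo --> d.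
    apply/cvgrPdist_le => e e0; near=> k; apply: (le_trans (near_d k).2).
    by near: k; apply: cvgr0_norm_le.
  have lod k : lo k <= d by rewrite /lo ge_min lexx.
  have dhi k : d <= hi k by rewrite /hi le_max lexx.
  have dlo k : d / 2 < lo k.
    have [+ _] := near_d k; have := u'd k; rewrite ler_norml; lra.
  have hid k : hi k <= 2 * d.
    have [_] := near_d k; have := u'd k; rewrite ler_norml; lra.
  apply: (@cvg_trans _ (\sum_(b : bool)
      (\int[lebesgue_rV R n]_z half_slice (half b) (lo k) (hi k) z) /
      (hi k - lo k) @[k --> \oo])).
    apply: near_eq_cvg; near=> k; rewrite -mulr_suml -int_oshell// -AE//.
    have -> : u k = u' k by near: k.
    rewrite [_ *: 1]mulr1 [RHS]mulrC /lo /hi.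
    have := dn k; case: (ltgtP d (u' k + d)) => // _ _; first by rewrite addrK.
    by rewrite opprD addrCA subrr addr0 invrN mulrN -mulNr opprB.
  have hs b : (\int[lebesgue_rV R n]_z half_slice (half b) (lo k) (hi k) z) /
      (hi k - lo k) @[k --> \oo] -->
      \int[lebesgue_rV R n]_(z in [set z | enorm z < d])
        (half b (height d z, z) * (d / height d z)).
    apply: (@half_shell_cvg _ _ (half b) d M) => //.
    - by move=> t z dz; apply: FM; rewrite enorm_cons_sign.
    - by move=> z zd; exact: Fc.
  rewrite /sphere_flux big_bool.
  apply: cvg_trans (cvgD (hs true) (hs false)); apply: near_eq_cvg; near=> k.
  by rewrite big_bool.
apply: DeriveDef; first by apply/cvg_ex; exists sphere_flux.
by apply/cvg_lim.
Unshelve. all: by end_near. Qed.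

End sphere_derivative.

(** * The bilinear form over shells of increments *)

Section form.
Context (R : realType) (n : nat).
Local Notation leb := (lebesgue_rV R n.+1).
Local Notation rV := 'rV[R]_n.+1.
Implicit Types u v : rV -> R.

Lemma Lfun2_sqint u : u \in Lfun leb 2%:E -> sqint leb u.
Proof.
move=> Lu; split; last exact: (Lfun2_integrable_sqr Lu).
by move: Lu; rewrite inE => /andP[]; rewrite inE.
Qed.

Lemma L2norm_l2norm (Omega : set rV) u : measurable Omega -> sqint leb u ->
  {ae leb, forall x, ~ Omega x -> u x = 0} -> L2norm Omega u = l2norm leb u.
Proof.
move=> mO [mu iu] u0.
pose w := u \_ Omega.
have mw : measurable_fun setT w.
  by apply/(measurable_restrictT _ _).1 => //; exact: measurable_funTS.
have E : (\int[leb]_x (`|(EFin \o w) x| `^ 2) = (\int[leb]_x (u x ^+ 2))%R%:E)%E.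
  rewrite /Rintegral fineK; last exact: integrable_fin_num.
  apply: ae_eq_integral => //.
  - under eq_fun do rewrite abse_EFin poweR_EFin powR_mulrn//.
    by apply/measurable_EFinP; apply: measurable_funX; exact: measurableT_comp.
  - by apply/measurable_EFinP; exact: measurable_funX.
  - apply: filterS u0 => x ux _; rewrite abse_EFin poweR_EFin powR_mulrn//.
    rewrite real_normK ?num_real// /w /patch; case: ifPn => // xO.
    by rewrite ux// => /mem_set; apply/negP.
rewrite /L2norm /l2norm; set N := Lnorm _ _ _.
have N2 : (N `^ 2 = (\int[leb]_x (u x ^+ 2))%R%:E)%E.
  by rewrite /N powR_Lnorm.
have N0 : (0 <= N)%E by exact: Lnorm_ge0.
have I0 := int_sqr_ge0 leb u.
case: N N0 N2 => [r|//|//]; rewrite ?lee_fin => r0.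
  by rewrite poweR_EFin powR_mulrn// => -[<-]; rewrite sqrtr_sqr ger0_norm.
by rewrite poweRyr.
Qed.

Definition kernel_int u v (p : R) (z : rV * rV) : R :=
  (u z.1 - u z.2) * (v z.1 - v z.2) / enorm (z.1 - z.2) `^ p.

Lemma measurable_dist : measurable_fun setT (fun z : rV * rV => enorm (z.1 - z.2)).
Proof.
apply: (measurableT_comp (@measurable_enorm R n.+1)).
exact: measurable_rVD measurable_fst (measurable_rVN measurable_snd).
Qed.

Lemma measurable_kernel_int u v p :
  measurable_fun setT u -> measurable_fun setT v ->
  measurable_fun setT (kernel_int u v p).
Proof.
move=> mu mv; have md (w : rV -> R) : measurable_fun setT w ->
    measurable_fun setT (fun z : rV * rV => w z.1 - w z.2).
  move=> mw; apply: measurable_funB.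
    exact: measurableT_comp mw measurable_fst.
  exact: measurableT_comp mw measurable_snd.
apply: measurable_funM; first by apply: measurable_funM; exact: md.
apply: (measurableT_comp (@measurable_enorm_powRV R n.+1 p)).
exact: measurable_rVD measurable_fst (measurable_rVN measurable_snd).
Qed.

Lemma gagliardo_integrable t v : measurable_fun setT v ->
  (gagliardo_seminorm t v < +oo)%E ->
  (leb \x leb)%E.-integrable setT (EFin \o kernel_int v v (n.+1%:R + 2 * t)).
Proof.
move=> mv; rewrite /gagliardo_seminorm; set I := integral _ _ _ => Ioo.
have {}Ioo : (I < +oo)%E by apply: lty_poweRy Ioo; rewrite invr_neq0.
apply/integrableP; split.
  by apply/measurable_EFinP; exact: measurable_kernel_int.
apply: le_lt_trans Ioo; rewrite le_eqVlt; apply/orP; left; apply/eqP.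
apply: eq_integral => z _ /=; rewrite ger0_norm /kernel_int -expr2//.
by rewrite mulr_ge0 ?sqr_ge0 ?invr_ge0 ?powR_ge0.
Qed.

(** The product a b / r^(N+s+t) is split as a / r^(N/2+s) times b / r^(N/2+t);
    as r <= m, a smaller exponent p only costs a power of m. *)
Lemma kernel_int_le u v (s t p m : R) (z : rV * rV) :
  0 < p -> 0 < m -> p <= n.+1%:R + s + t -> enorm (z.1 - z.2) <= m ->
  `|kernel_int u v p z| <= m `^ (n.+1%:R + s + t - p) *
    (kernel_int u u (n.+1%:R + 2 * s) z + kernel_int v v (n.+1%:R + 2 * t) z).
Proof.
move=> p0 m0 pq rm; rewrite /kernel_int.
set a := u z.1 - u z.2; set b := v z.1 - v z.2; set r := enorm _.
have [r0|r0] := eqVneq r 0.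
  rewrite r0 [X in _ / X]powR0 ?gt_eqF// invr0 mulr0 normr0.
  rewrite mulr_ge0 ?powR_ge0// addr_ge0// mulr_ge0 ?invr_ge0 ?powR_ge0//.
    by rewrite -expr2 sqr_ge0.
  by rewrite -expr2 sqr_ge0.
have rp : 0 < r by rewrite lt_def r0 enorm_ge0.
pose x := `|a| / r `^ ((n.+1%:R + 2 * s) / 2).
pose y := `|b| / r `^ ((n.+1%:R + 2 * t) / 2).
have sq (c e : R) : c * c / r `^ e = (`|c| / r `^ (e / 2)) ^+ 2.
  rewrite expr_div_n real_normK ?num_real// -expr2.
  rewrite -[(r `^ _) ^+ 2]powR_mulrn ?powR_ge0//.
  by rewrite -powRrM divfK.
rewrite !sq -/x -/y.
apply: (@le_trans _ _ (m `^ (n.+1%:R + s + t - p) * (x * y))); last first.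
  by rewrite ler_wpM2l ?powR_ge0// ler_mul_sqr.
rewrite normrM normfV (ger0_norm (powR_ge0 _ _)) normrM.
have -> : x * y = `|a| * `|b| / r `^ (n.+1%:R + s + t).
  rewrite /x /y mulrACA -invfM -powRD; last by rewrite r0 implybT.
  by congr (_ / _ `^ _); field.
rewrite mulrCA ler_wpM2l ?mulr_ge0//.
have -> : r `^ (n.+1%:R + s + t) = r `^ (n.+1%:R + s + t - p) * r `^ p.
  by rewrite -powRD ?subrK// r0 implybT.
rewrite invfM mulrA ler_peMl ?invr_ge0 ?powR_ge0//.
rewrite ler_pdivlMr ?powR_gt0// mul1r ge0_ler_powR ?nnegrE ?(ltW m0) ?(ltW rp)//.
by rewrite subr_ge0.
Qed.

Lemma form_integrable u v (s t p m : R) :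
  measurable_fun setT u -> measurable_fun setT v ->
  (gagliardo_seminorm s u < +oo)%E -> (gagliardo_seminorm t v < +oo)%E ->
  0 < p -> 0 < m -> p <= n.+1%:R + s + t ->
  (leb \x leb)%E.-integrable [set z | enorm (z.1 - z.2) <= m]
    (EFin \o kernel_int u v p).
Proof.
move=> mu mv su tv p0 m0 pq.
have mD : measurable [set z : rV * rV | enorm (z.1 - z.2) <= m].
  rewrite (_ : [set z | _] =
      (fun z : rV * rV => enorm (z.1 - z.2)) @^-1` `]-oo, m]%classic).
    by rewrite -[X in measurable X]setTI; exact: measurable_dist.
  by apply/seteqP; split => z /=; rewrite in_itv.
have iU := gagliardo_integrable mu su; have iV := gagliardo_integrable mv tv.
apply: (@le_integrable _ _ _ _ _ mD _ (fun z => (m `^ (n.+1%:R + s + t - p))%:E *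
  ((kernel_int u u (n.+1%:R + 2 * s) z)%:E +
   (kernel_int v v (n.+1%:R + 2 * t) z)%:E))%E).
- by apply: measurable_funTS; apply/measurable_EFinP; exact: measurable_kernel_int.
- move=> z zm /=; rewrite lee_fin.
  by apply: (le_trans (kernel_int_le u v p0 m0 pq zm)); exact: ler_norm.
- apply: integrableZl => //; apply: integrableD => //.
    by apply: integrableS iU => //; exact: measurableT.
  by apply: integrableS iV => //; exact: measurableT.
Qed.

(** Integrating over the pairs at distance in ]lo, hi] and applying the shear; the
    integral in x of the numerator is [increment_form]. *)
Lemma form_a_oshell u v (s t s' lo hi : R) :
  sqint leb u -> sqint leb v ->
  (gagliardo_seminorm s u < +oo)%E -> (gagliardo_seminorm t v < +oo)%E ->
  0 < s' -> 2 * s' <= s + t -> 0 < lo -> lo < hi ->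
  form_a u v s' hi - form_a u v s' lo = \int[leb]_(h in oshell lo hi)
    (increment_form u v h / enorm h `^ (n.+1%:R + 2 * s')).
Proof.
move=> su sv us vt s'0 s'st lo0 lohi; have hi0 := lt_trans lo0 lohi.
have [mu _] := su; have [mv _] := sv.
set p := n.+1%:R + 2 * s'.
have p0 : 0 < p by rewrite addr_gt0 ?mulr_gt0.
have pst : p <= n.+1%:R + s + t by rewrite /p -addrA lerD2l.
have iK := form_integrable mu mv us vt p0 hi0 pst.
pose S := [set z : rV * rV | lo < enorm (z.1 - z.2) <= hi].
have mS : measurable S.
  rewrite (_ : S = (fun z : rV * rV => enorm (z.1 - z.2)) @^-1` `]lo, hi]%classic).
    by rewrite -[X in measurable X]setTI; exact: measurable_dist.
  by apply/seteqP; split => z; rewrite /S /= in_itv.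
have mL : measurable [set z : rV * rV | enorm (z.1 - z.2) <= lo].
  rewrite (_ : [set z | _] =
      (fun z : rV * rV => enorm (z.1 - z.2)) @^-1` `]-oo, lo]%classic).
    by rewrite -[X in measurable X]setTI; exact: measurable_dist.
  by apply/seteqP; split => z /=; rewrite in_itv.
have DE : [set z : rV * rV | enorm (z.1 - z.2) <= hi] =
    [set z : rV * rV | enorm (z.1 - z.2) <= lo] `|` S.
  apply/seteqP; split => z; rewrite /S /=.
    by move=> zhi; have [zlo|zlo] := leP (enorm (z.1 - z.2)) lo; [left|right].
  by move=> [zlo|/andP[]//]; exact: le_trans zlo (ltW lohi).
rewrite /form_a -/(kernel_int u v p _) DE Rintegral_setU//; last 2 first.
- by rewrite -DE.
- by apply/disj_setPS => z; rewrite /S /= => -[zlo /andP[]]; rewrite ltNge zlo.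
(* the integrals over |x - y| <= lo cancel *)
rewrite addrAC subrr add0r.
have mKS : measurable_fun setT (kernel_int u v p \_ S).
  apply/(measurable_restrictT _ _).1 => //.
  by apply: measurable_funTS; exact: measurable_kernel_int.
have iKS : (leb \x leb)%E.-integrable setT (EFin \o (kernel_int u v p \_ S)).
  rewrite -restrict_EFin; apply/(integrable_mkcond _ mS).1.
  by apply: integrableS iK => //; rewrite DE; [exact: measurableU|move=> z; right].
have mKSE : measurable_fun setT (EFin \o (kernel_int u v p \_ S)).
  exact/measurable_EFinP.
have iKc := (integrable_preserving (preserving_shear R n.+1) mKSE).1 iKS.
rewrite Rintegral_mkcond (Rintegral_preserving (preserving_shear R n.+1) mKS).
rewrite (Rfubini2 iKc) [RHS]Rintegral_mkcond; apply: eq_Rintegral => h _ /=.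
have xh x : x - (x + h) = - h by rewrite opprD addrA subrr add0r.
have -> : \int[leb]_x (kernel_int u v p \_ S) (x, x + h) =
    \int[leb]_x ((fun x => (u x - u (x + h)) * (v x - v (x + h)) / enorm h `^ p)
      x *+ (h \in oshell lo hi)).
  apply: eq_Rintegral => x _; rewrite /patch.
  have -> : ((x, x + h) \in S) = (h \in oshell lo hi).
    by apply/idP/idP; rewrite !inE /S /oshell /= xh enormN.
  by case: ifP => _; rewrite ?mulr0n// mulr1n /kernel_int /= xh enormN.
rewrite /patch; case: ifP => _; last first.
  by under eq_Rintegral do rewrite mulr0n; rewrite Rintegral_cst// mul0r.
under eq_Rintegral do rewrite mulr1n.
by rewrite RintegralZr//; exact: sqint_mul (sqint_diff h su) (sqint_diff h sv).
Qed.

End form.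

(** * The surface integral *)

Lemma integrable_Rfubini1 d1 d2 (T1 : measurableType d1)
    (T2 : measurableType d2) (R : realType)
    (m1 : {sigma_finite_measure set T1 -> \bar R})
    (m2 : {sigma_finite_measure set T2 -> \bar R}) (f : T1 * T2 -> R) :
  (m1 \x m2)%E.-integrable setT (EFin \o f) ->
  m1.-integrable setT (EFin \o (fun x => \int[m2]_y f (x, y))).
Proof.
move=> If; have iF := integrable_fubini_F If.
apply: (le_integrable measurableT _ _ iF).
  apply/measurable_EFinP; apply: (@measurableT_comp _ _ _ _ _ _ (@fine R)).
    exact: fine_measurable.
  exact: (measurable_int m1 iF).
move=> x _; rewrite /= /Rintegral /fubini_F.
by case: (integral _ _ _) => [r||] //=; rewrite normr0 leey.
Qed.

Section sphere.
Context (R : realType) (n : nat).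
Local Notation leb := (lebesgue_rV R n.+1).
Local Notation rV := 'rV[R]_n.+1.
Variables (u v : rV -> R) (d : R).
Hypotheses (su : sqint leb u) (sv : sqint leb v) (d0 : 0 < d).

(** Point of the sphere of radius d above z, or below it if [b]. *)
Definition sphere_point (b : bool) (z : 'rV[R]_n) : rV :=
  cons_rV ((-1) ^+ b * height d z, z).

(** The surface integral of [increment_form] over the sphere of radius d. *)
Definition sphere_increment := \sum_(b : bool)
  \int[lebesgue_rV R n]_z
    (increment_form u v (sphere_point b z) * (d / height d z)).

Lemma enorm_sphere_point b z : enorm z < d -> enorm (sphere_point b z) = d.
Proof.
move=> zd; apply/eqP; rewrite -(@eqrXn2 _ 2) ?enorm_ge0 ?(ltW d0)//.
rewrite enorm_cons_sign enorm_cons/= sqr_sqrtr ?subrK// subr_ge0.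
by rewrite ler_pXn2r ?nnegrE ?enorm_ge0 ?(ltW d0)// ltW.
Qed.

Lemma measurable_sphere_point b : measurable_fun setT (sphere_point b).
Proof.
apply: (measurableT_comp (@measurable_cons_rV R n)).
apply/measurable_fun_pairP; split; last exact: measurable_id.
apply: measurable_funM; first exact: measurable_cst.
exact: measurable_height.
Qed.

Lemma int_ball_height (f : 'rV[R]_n -> R) :
  \int[lebesgue_rV R n]_(z in [set z | enorm z < d]) (f z * (d / height d z)) =
  \int[lebesgue_rV R n]_z (f z * (d / height d z)).
Proof.
rewrite Rintegral_mkcond; apply: eq_Rintegral => z _; rewrite /patch.
case: ifPn => // zd; rewrite height_eq0 ?(ltW d0) ?invr0 ?mulr0//.
by rewrite leNgt; apply: contra zd => zd; apply/mem_set.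
Qed.

Lemma integrable_sphere_increment b : (lebesgue_rV R n).-integrable setT
  (EFin \o (fun z => increment_form u v (sphere_point b z) * (d / height d z))).
Proof.
have [mu _] := su; have [mv _] := sv.
apply: (le_integrable measurableT _ _ (@integrable_heightV R n
  (4 * l2norm leb u * l2norm leb v * d) d d0)).
  apply/measurable_EFinP; apply: measurable_funM.
    exact: measurableT_comp (measurable_increment_form mu mv)
      (measurable_sphere_point b).
  by apply: measurable_funM => //; exact: measurable_heightV.
move=> z _ /=; rewrite lee_fin mulrA normrM [leRHS]normrM ler_wpM2r//.
rewrite normrM [leRHS]normrM ler_wpM2r//.
exact: le_trans (increment_form_le _ su sv) (ler_norm _).
Qed.

Lemma sphere_increment_le : `|sphere_increment| <=
  8 * (d * heightV_bound n d) * (l2norm leb u * l2norm leb v).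
Proof.
pose K := 4 * l2norm leb u * l2norm leb v.
have K0 : 0 <= K by rewrite !mulr_ge0 ?l2norm_ge0.
have iH := @integrable_heightV R n (K * d) d d0.
have le b : `|\int[lebesgue_rV R n]_z
    (increment_form u v (sphere_point b z) * (d / height d z))| <=
    K * d * heightV_bound n d.
  have iI := integrable_sphere_increment b.
  apply: (le_trans (le_normr_Rintegral measurableT iI)).
  apply: (@le_trans _ _ (\int[lebesgue_rV R n]_z (K * d * (height d z)^-1))).
    apply: le_Rintegral => //; first exact: (integrable_norm iI).
    move=> z _; rewrite mulrA normrM [X in _ * X]ger0_norm ?invr_ge0 ?height_ge0//.
    rewrite ler_wpM2r ?invr_ge0 ?height_ge0// normrM (gtr0_norm d0).
    rewrite ler_wpM2r ?(ltW d0)//.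
    exact: increment_form_le.
  have iH1 : (lebesgue_rV R n).-integrable setT (EFin \o (fun z => (height d z)^-1)).
    by have := @integrable_heightV R n 1 d d0; under eq_fun do rewrite mul1r.
  rewrite RintegralZl// ler_wpM2l ?(mulr_ge0 K0 (ltW d0))//.
  rewrite -lee_fin /Rintegral fineK; first exact: integral_heightV.
  exact: integrable_fin_num.
rewrite /sphere_increment big_bool/=; apply: (le_trans (ler_normD _ _)).
apply: (le_trans (lerD (le true) (le false))).
by rewrite le_eqVlt; apply/orP; left; apply/eqP; rewrite /K; ring.
Qed.

(** On the sphere the weight |h|^(N + 2s') is constant, so it factors out. *)
Lemma form_a_is_derive (s t s' : R) : 0 < t ->
  (gagliardo_seminorm s u < +oo)%E -> (gagliardo_seminorm t v < +oo)%E ->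
  0 < s' -> 2 * s' <= s + t ->
  is_derive d 1 (form_a u v s')
    (sphere_increment / d `^ (n.+1%:R + 2 * s')).
Proof.
move=> t0 us vt s'0 s'st; have [mu _] := su; have [mv _] := sv.
set p := n.+1%:R + 2 * s'.
have p0 : 0 < p by rewrite addr_gt0 ?mulr_gt0.
pose F h := increment_form u v h / enorm h `^ p.
pose K := 4 * l2norm leb u * l2norm leb v.
have K0 : 0 <= K by rewrite !mulr_ge0 ?l2norm_ge0.
have d20 : 0 < d / 2 by rewrite divr_gt0.
have mF : measurable_fun setT F.
  apply: measurable_funM; first exact: measurable_increment_form.
  exact: measurable_enorm_powRV.
have FM h : d / 2 < enorm h -> `|F h| <= K / (d / 2) `^ p.
  move=> dh; rewrite normrM; apply: ler_pM => //; first exact: increment_form_le.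
  have hp := lt_trans d20 dh.
  rewrite normfV (ger0_norm (powR_ge0 _ _)) lef_pV2 ?posrE ?powR_gt0//.
  by rewrite ge0_ler_powR ?nnegrE ?(ltW p0) ?(ltW d20) ?(ltW hp) ?(ltW dh).
have Fc (b : bool) z : enorm z < d ->
    F (cons_rV ((-1) ^+ b * x, z)) @[x --> height d z] -->
    F (cons_rV ((-1) ^+ b * height d z, z)).
  move=> zd; apply: cvgM.
    have c1 : `|(-1) ^+ b| = 1 :> R by rewrite normrX normrN1 expr1n.
    exact: (increment_form_continuous t0 su sv vt c1).
  have E x : enorm (cons_rV ((-1) ^+ b * x, z)) = Num.sqrt (x ^+ 2 + enorm z ^+ 2).
    rewrite enorm_cons_sign -(ger0_norm (enorm_ge0 (cons_rV _))).
    by rewrite -sqrtr_sqr enorm_cons.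
  have dE : enorm (cons_rV ((-1) ^+ b * height d z, z)) = d.
    exact: enorm_sphere_point.
  apply: cvgV; first by rewrite dE gt_eqF// powR_gt0.
  rewrite dE; rewrite (_ : (fun x => _) =
      (fun x => Num.sqrt (x ^+ 2 + enorm z ^+ 2) `^ p)); last first.
    by apply/funext => x; rewrite E.
  have cs : Num.sqrt (x ^+ 2 + enorm z ^+ 2) @[x --> height d z] --> d.
    rewrite -[X in _ --> X]dE E.
    apply: continuous_cvg; first exact (@sqrt_continuous R _).
    by apply: cvgD; [exact: exprn_continuous|exact: cvg_cst].
  have cp : {for d, continuous (fun y : R => y `^ p)}.
    apply/differentiable_continuous/derivable1_diffP.
    by apply: derivable_powR; rewrite in_itv/= d0.
  exact: cvg_comp cs cp.
have M0 : 0 <= K / (d / 2) `^ p by rewrite divr_ge0 ?powR_ge0.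
have := @sphere_is_derive R n F d (K / (d / 2) `^ p) mF d0 M0 FM Fc (form_a u v s').
rewrite (_ : sphere_flux F d = sphere_increment / d `^ p).
  apply=> lo hi dlo lohi; apply: (form_a_oshell su sv us vt) => //.
  exact: lt_trans dlo.
rewrite /sphere_flux /sphere_increment mulr_suml; apply: eq_bigr => b _.
rewrite -RintegralZr//; last exact: integrable_sphere_increment.
transitivity (\int[lebesgue_rV R n]_z
    (increment_form u v (sphere_point b z) / d `^ p * (d / height d z))).
  rewrite -int_ball_height; apply: eq_Rintegral => z /set_mem/= zd.
  by rewrite /F -/(sphere_point b z) enorm_sphere_point.
by apply: eq_Rintegral => z _; rewrite mulrAC.
Qed.

(** The integrand is integrable in (x, z), its integral in x being bounded
    independently of z and the surface element being integrable.  The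
    constants stay inside the integrals until x and z are exchanged, because for
    a single x the integral in z need not converge. *)
Lemma int_sphere_integral p :
  \int[leb]_x sphere_integral x d (fun y =>
    (u x - u y) * (v x - v y) * ln (enorm (x - y)) / enorm (x - y) `^ p) =
  ln d / d `^ p * sphere_increment.
Proof.
have [mu _] := su; have [mv _] := sv.
pose G b (q : rV * 'rV[R]_n) :=
  (u q.1 - u (q.1 + sphere_point b q.2)) *
  (v q.1 - v (q.1 + sphere_point b q.2)) * (d / height d q.2).
have mG b : measurable_fun setT (G b).
  have mw (w : rV -> R) : measurable_fun setT w -> measurable_fun setT
      (fun q : rV * 'rV[R]_n => w q.1 - w (q.1 + sphere_point b q.2)).
    move=> mw; apply: measurable_funB.
      exact: measurableT_comp mw measurable_fst.
    apply: (measurableT_comp mw); apply: measurable_rVD; first exact: measurable_fst.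
    exact: measurableT_comp (measurable_sphere_point b) measurable_snd.
  apply: measurable_funM; first by apply: measurable_funM; exact: mw.
  apply: measurable_funM => //.
  exact: measurableT_comp (@measurable_heightV R n d) measurable_snd.
have iG b : (leb \x lebesgue_rV R n)%E.-integrable setT (EFin \o G b).
  have mGE : measurable_fun setT (EFin \o G b) by apply/measurable_EFinP; exact: mG.
  apply/integrable21ltyP; first exact: mGE.
  pose B := (2 * l2norm leb u) ^+ 2 + (2 * l2norm leb v) ^+ 2.
  have iH := @integrable_heightV R n (B * d) d d0.
  have [_ Hoo] := integrableP _ _ _ iH; apply: le_lt_trans Hoo.
  apply: ge0_le_integral => //.
  - by move=> z _; exact: integral_ge0.
  - apply: (@measurable_fun_fubini_tonelli_G _ _ _ _ _ leb
      (fun q => `|(G b q)%:E|%E)) => //.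
    exact: measurableT_comp mGE.
  - by apply: measurableT_comp => //; apply/measurable_EFinP;
      apply: measurable_funM => //; exact: measurable_heightV.
  - move=> z _; have [mdu idu] := sqint_diff (sphere_point b z) su.
    have [mdv idv] := sqint_diff (sphere_point b z) sv.
    rewrite /fubini_G /=; set h := sphere_point b z; set c := d / height d z.
    have c0 : 0 <= c by rewrite divr_ge0 ?height_ge0 ?(ltW d0).
    have iS := integrableD measurableT idu idv.
    apply: (@le_trans _ _ (\int[leb]_x
        (((u x - u (x + h)) ^+ 2 + (v x - v (x + h)) ^+ 2) * c)%:E)%E).
      apply: ge0_le_integral => //.
      + apply/measurable_EFinP; apply: measurableT_comp => //.
        exact: measurableT_comp (mG b) (measurable_pair2 z).
      + apply/measurable_EFinP; apply: measurable_funM => //.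
        by apply: measurable_funD; exact: measurable_funX.
      + move=> x _; rewrite lee_fin /G /= -/h -/c normrM (ger0_norm c0).
        rewrite ler_wpM2r// normrM (le_trans (ler_mul_sqr _ _))//.
        by rewrite !real_normK ?num_real.
    have iSc : leb.-integrable setT (EFin \o (fun x =>
        ((u x - u (x + h)) ^+ 2 + (v x - v (x + h)) ^+ 2) * c)).
      by rewrite /comp; under eq_fun do rewrite EFinM; exact: integrableZr.
    rewrite -[leLHS]fineK; last exact: integrable_fin_num.
    rewrite -/(Rintegral leb setT (fun x =>
        ((u x - u (x + h)) ^+ 2 + (v x - v (x + h)) ^+ 2) * c)).
    rewrite RintegralZr// RintegralD// -!l2normK lee_fin.
    apply: le_trans (ler_norm _); rewrite -mulrA ler_wpM2r// lerD//.
      by rewrite ler_pXn2r ?nnegrE ?mulr_ge0 ?l2norm_ge0// l2norm_increment.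
    by rewrite ler_pXn2r ?nnegrE ?mulr_ge0 ?l2norm_ge0// l2norm_increment.
pose c := ln d / d `^ p.
have iGc b : (leb \x lebesgue_rV R n)%E.-integrable setT
    (EFin \o (fun q => c * G b q)).
  rewrite /comp; under eq_fun do rewrite EFinM.
  by apply: integrableZl => //; exact: iG.
have E x : sphere_integral x d (fun y =>
    (u x - u y) * (v x - v y) * ln (enorm (x - y)) / enorm (x - y) `^ p) =
    \int[lebesgue_rV R n]_z (c * G true (x, z)) +
    \int[lebesgue_rV R n]_z (c * G false (x, z)).
  have half (b : bool) : \int[lebesgue_rV R n]_(z in [set z | enorm z < d])
      ((u x - u (x + sphere_point b z)) * (v x - v (x + sphere_point b z)) *
       ln (enorm (x - (x + sphere_point b z))) /
       enorm (x - (x + sphere_point b z)) `^ p * (d / height d z)) =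
      \int[lebesgue_rV R n]_z (c * G b (x, z)).
    rewrite Rintegral_mkcond; apply: eq_Rintegral => z _; rewrite /patch /G /=.
    case: ifPn => [/set_mem/= zd|zd]; last first.
      rewrite height_eq0 ?(ltW d0) ?invr0 ?mulr0//.
      by rewrite leNgt; apply: contra zd => zd; apply/mem_set.
    rewrite opprD addrA subrr add0r enormN enorm_sphere_point// /c.
    by ring.
  by rewrite /sphere_integral big_bool -!half.
under eq_Rintegral do rewrite E.
have i1 b := integrable_Rfubini1 (iGc b).
rewrite RintegralD//.
rewrite -(Rfubini1 (iGc true)) -(Rfubini1 (iGc false)).
rewrite (Rfubini2 (iGc true)) (Rfubini2 (iGc false)).
have E2 b : \int[lebesgue_rV R n]_z \int[leb]_x (c * G b (x, z)) =
    c * \int[lebesgue_rV R n]_z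
      (increment_form u v (sphere_point b z) * (d / height d z)).
  rewrite -RintegralZl//; last exact: integrable_sphere_increment.
  apply: eq_Rintegral => z _.
  have i2 := sqint_mul (sqint_diff (sphere_point b z) su)
    (sqint_diff (sphere_point b z) sv).
  rewrite RintegralZl//; first by rewrite /G /= RintegralZr.
  rewrite /G /comp /=; under eq_fun do rewrite EFinM.
  exact: integrableZr.
by rewrite !E2 -mulrDr /sphere_increment big_bool.
Qed.

End sphere.

(** * The mixed derivative *)

(** An open set is the union of the boxes with rational centre and radius
    1 / (k + 1) that it contains, and there are countably many of them. *)
Lemma measurable_open_rV (R : realType) n (O : set 'rV[R]_n) :
  open O -> measurable O.
Proof.
move=> oO.
pose box (q : 'rV[rat]_n * nat) : set 'rV[R]_n :=
  [set x | forall i, `|x 0 i - ratr (q.1 0 i)| < q.2.+1%:R^-1].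
have mbox q : measurable (box q).
  rewrite (_ : box q = \big[setI/setT]_(i < n) ((fun x : 'rV[R]_n => x 0 i) @^-1`
      ball (ratr (q.1 0 i) : R) q.2.+1%:R^-1)).
    apply: bigsetI_measurable => i _; rewrite -[X in measurable X]setTI.
    by apply: measurable_coor => //; exact: measurable_ball.
  rewrite -bigcap_seq; apply/seteqP; split => x /= h i.
    by move=> _; rewrite /ball /= distrC; exact: h.
  by have := h i; rewrite /= mem_index_enum /ball /= distrC; exact.
rewrite (_ : O = \bigcup_(q in [set q | box q `<=` O]) box q).
  rewrite bigcup_mkcond.
  apply: countable_bigcupT_measurable; first exact: countableP.
  by move=> q; case: ifP.
apply/seteqP; split => [x Ox|x [q /= qO] /qO//].
have /nbhs_ballP[e /= e0 eO] : nbhs x O by exact: open_nbhs_nbhs.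
pose k := Num.truncn (2 / e).
have k0 : 0 < k.+1%:R^-1 :> R by rewrite invr_gt0 ltr0n.
have ke : k.+1%:R^-1 + k.+1%:R^-1 <= e.
  have : k.+1%:R^-1 <= e / 2.
    rewrite -[leRHS]invrK lef_pV2 ?posrE ?ltr0n ?invr_gt0 ?divr_gt0//.
    by rewrite invf_div ltW// truncnS_gt.
  by move=> h; rewrite (splitr e) lerD.
have rq i : {q : rat | `|x 0 i - ratr q| < k.+1%:R^-1}.
  apply: cid; have xk : x 0 i < x 0 i + k.+1%:R^-1 by rewrite ltrDl.
  have [q] := rat_in_itvoo xk; rewrite in_itv/= => /andP[xq qx]; exists q.
  by rewrite distrC gtr0_norm ?subr_gt0// ltrBlDl.
exists (\row_i sval (rq i), k) => /=.
  move=> y /= yb; apply: eO; split=> // i j; rewrite !ord1 /ball /=.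
  have := yb j; rewrite mxE; case: (rq j) => q /= xq yq.
  rewrite -(subrKA (ratr q)); apply: le_lt_trans (ler_normD _ _) _.
  by apply: lt_le_trans ke; apply: ltrD => //; rewrite distrC.
by move=> i; rewrite mxE; case: (rq i).
Qed.

Lemma is_derive_near_eq (R : realType) (f g : R -> R) (x l : R) :
  (\forall y \near x, f y = g y) -> is_derive x 1 g l -> is_derive x 1 f l.
Proof.
move=> fg [dg lg].
have fgx : f x = g x by exact: nbhs_singleton fg.
have cv : h^-1 *: (f (h *: (1 : R) + x) - f x) @[h --> 0^'] --> l.
  rewrite -lg; apply: cvg_trans dg; apply: near_eq_cvg.
  have sh : (fun h : R => h *: (1 : R) + x) @ 0^' --> x.
    apply/cvgrPdist_le => e e0; near=> h.
    rewrite [_ *: _]mulr1 opprD addrCA subrr addr0 normrN.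
    by near: h; exact: dnbhs0_le.
  near=> h; rewrite fgx; congr (_ *: (_ - _)); apply/esym; near: h.
  exact: sh fg.
apply: DeriveDef; first by apply/cvg_ex; exists l.
exact/cvg_lim.
Unshelve. all: by end_near. Qed.

Lemma continuous_heightV_bound (R : realType) n (d : R) : 0 < d ->
  {for d, continuous (@heightV_bound R n)}.
Proof.
move=> d0; case: n => [|n] /=; first by apply: cvgV; [rewrite gt_eqF|].
have c2 : (fun r : R => 2 * r) @ d --> 2 * d.
  by apply: cvgM; [exact: cvg_cst|].
have ce : x ^+ n @[x --> 2 * d] --> (2 * d) ^+ n by exact: exprn_continuous.
have c3 : (2 * x) ^+ n @[x --> d] --> (2 * d) ^+ n by exact: cvg_comp c2 ce.
by apply: cvgM; [exact: cvg_cst|exact: c3].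
Qed.

Theorem proposition3p3 (R : realType) (n : nat) (Omega : set 'rV[R]_n.+1)
    (hOmega : smooth_bounded_domain Omega) :
  exists C : R * R -> R,
    {within [set p : R * R | 0 < p.1 < 1 /\ 0 < p.2], continuous C} /\
    forall s delta alpha : R, 0 < delta -> 0 < s < 1 -> 0 < alpha < 1 - s ->
    forall u v : 'rV[R]_n.+1 -> R,
      H_Omega Omega (s + alpha) u -> H_Omega Omega s v ->
      [/\ \forall s' \near s, derivable (form_a u v s') delta 1,
          derivable (fun s' : R => derive1 (form_a u v s') delta) s 1,
          mixed_derivative u v s delta =
            - 2 * \int[lebesgue_rV R n.+1]_x
                    sphere_integral x delta (fun y =>
                      (u x - u y) * (v x - v y) * ln (enorm (x - y)) /
                      enorm (x - y) `^ (n.+1%:R + 2 * s)) &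
          `|mixed_derivative u v s delta| <=
            C (s, delta) * L2norm Omega u * L2norm Omega v].
Proof.
pose C (p : R * R) := 16 * `|ln p.2| *
  expR (- ((n.+1%:R + 2 * p.1) * ln p.2)) * (p.2 * heightV_bound n p.2).
exists C; split.
  apply: continuous_in_subspaceT => p /set_mem[_ p2].
  have c1 : q.1 @[q --> p] --> p.1 by exact: cvg_fst.
  have c2 : q.2 @[q --> p] --> p.2 by exact: cvg_snd.
  have cl : ln q.2 @[q --> p] --> ln p.2.
    by apply: continuous_cvg => //; exact: continuous_ln.
  apply: cvgM; first apply: cvgM.
  - by apply: cvgMr; exact: cvg_norm.
  - apply: continuous_cvg; first exact: continuous_expR.
    apply: cvgN; apply: cvgM => //; apply: cvgD; first exact: cvg_cst.
    exact: cvgMr.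
  - apply: cvgM => //; apply: continuous_cvg => //.
    exact: continuous_heightV_bound.
move=> s d alpha d0 /andP[s0 s1] /andP[a0 a1] u v [Lu gu u0] [Lv gv v0].
have su := Lfun2_sqint Lu; have sv := Lfun2_sqint Lv.
have mO : measurable Omega.
  by case: hOmega => oO _ _ _ _; exact: measurable_open_rV.
have near_s : \forall s' \near s, 0 < s' /\ 2 * s' <= s + alpha + s.
  near=> s'; split; first by near: s'; exact: lt_nbhsr.
  have : s' < s + alpha / 2 by near: s'; apply: lt_nbhsl; rewrite ltrDl divr_gt0.
  lra.
pose S := sphere_increment u v d.
have der s' : 0 < s' /\ 2 * s' <= s + alpha + s ->
    is_derive d 1 (form_a u v s') (S / d `^ (n.+1%:R + 2 * s')).
  by move=> [s'0 s's]; exact: (form_a_is_derive su sv d0 s0 gu gv s'0 s's).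
have pwE q : (d `^ q)^-1 = expR (- (q * ln d)).
  by rewrite -powRN /powR gt_eqF// mulNr.
pose W s' := S * expR (- ((n.+1%:R + 2 * s') * ln d)).
have near_W : \forall s' \near s, derive1 (form_a u v s') d = W s'.
  apply: filterS near_s => s' /der ds'.
  by rewrite derive1E (@derive_val _ _ _ _ _ _ _ ds') pwE.
have dW : is_derive s 1 W (S * (- 2 * ln d / d `^ (n.+1%:R + 2 * s))).
  pose A : R -> R := ((- (2 * ln d)) \*: (@id R)) + cst (- (n.+1%:R * ln d)).
  have dA : is_derive (s : R) (1 : R) A (- (2 * ln d)).
    rewrite -[X in is_derive _ _ _ X]addr0 -[X in is_derive _ _ _ (X + _)]mulr1.
    exact: is_deriveD.
  have AE s' : A s' = - ((n.+1%:R + 2 * s') * ln d).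
    rewrite /A !fctE /= (_ : _ *: s' = - (2 * ln d) * s')//; ring.
  have WE : W = S \*: (expR \o A).
    by apply/funext => s'; rewrite /W -AE.
  have dE := is_derive1_comp (is_derive_expR (A s)) dA.
  rewrite WE pwE -(AE s).
  have -> : S * (- 2 * ln d * expR (A s)) = S *: (expR (A s) * - (2 * ln d)).
    transitivity (S * (expR (A s) * - (2 * ln d))) => //; ring.
  exact: is_deriveZ.
have dm := is_derive_near_eq near_W dW.
have mE : mixed_derivative u v s d = S * (- 2 * ln d / d `^ (n.+1%:R + 2 * s)).
  by rewrite /mixed_derivative derive1E (@derive_val _ _ _ _ _ _ _ dm).
split.
- by apply: filterS near_s => s' /der ds'; exact: (@ex_derive _ _ _ _ _ _ _ ds').
- exact: (@ex_derive _ _ _ _ _ _ _ dm).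
- rewrite int_sphere_integral// mE -/S; ring.
- rewrite mE (L2norm_l2norm mO su u0) (L2norm_l2norm mO sv v0).
  rewrite normrM /C /=.
  have := sphere_increment_le su sv d0; rewrite -/S.
  set H := d * heightV_bound n d; set U := l2norm _ u; set V := l2norm _ v => SH.
  rewrite normrM normrM normrN (ger0_norm (_ : 0 <= 2))//.
  rewrite pwE (ger0_norm (expR_ge0 _)).
  set E := expR _.
  apply: (@le_trans _ _ (8 * H * (U * V) * (2 * `|ln d| * E))).
    by rewrite ler_wpM2r// !mulr_ge0 ?expR_ge0.
  by rewrite le_eqVlt; apply/orP; left; apply/eqP; ring.
Unshelve. all: by end_near. Qed.
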